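(* Let $\varepsilon>0$ and $\nu>1/2$ be fixed, let $\Phi:\mathbb{R}\rightarrow \mathbb{R}_{\ge 0}$ be a Schwartz class function, and let $p>5$ be a fixed prime. For each natural number $n$ let $N=N(n)$ be a positive real number with $N\ge p^{n\nu}$. Then, as $n\rightarrow\infty$, $$ \sum\limits_{\substack{(x_1,x_2,x_3)\in \mathbb{Z}^3\\ \gcd(x_1x_2x_3,p)=1\\ x_1^2+x_2^2-x_3^2 \equiv 0 \bmod{p^n}}} \Phi\left(\frac{x_1}{N}\right) \Phi\left(\frac{x_2}{N}\right)\Phi\left(\frac{x_3}{N}\right)\sim \hat{\Phi}(0)^3\cdot \frac{(p-s(p))(p-1)}{p^2}\cdot \frac{N^3}{p^{n}}, $$ where $$ s(p):=\begin{cases} 3 & \mbox{ if } p\equiv 3\bmod{4},\\ 5 & \mbox{ if } p\equiv 1\bmod{4}. \end{cases} $$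
   Context: $\hat{\Phi}$ denotes the Fourier transform of $\Phi$, $\hat\Phi(y)=\int_{\mathbb{R}}\Phi(x)e^{-2\pi i xy}\,dx$; in particular $\hat{\Phi}(0)=\int_{\mathbb{R}}\Phi(x)\,dx$. The notation $A\sim B$ means $A/B\to 1$ as $n\to\infty$. *)

(* Defs.v *)
From HB Require Import structures.
From mathcomp Require Import all_boot all_order all_algebra.
From mathcomp Require Import complex.
From mathcomp Require Import all_classical all_reals all_analysis.

Set Implicit Arguments.
Unset Strict Implicit.
Unset Printing Implicit Defensive.
Import Order.TTheory GRing.Theory Num.Theory.
Import numFieldNormedType.Exports.
Local Open Scope classical_set_scope.
Local Open Scope ring_scope.
Local Open Scope complex_scope.

Definition schwartz (R : realType) (f : R -> R) : Prop :=
  (forall (k : nat) (x : R), derivable (f^`(k))%classic x 1) /\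
  (forall m k : nat, exists C : R,
     forall x : R, `|x| ^+ m * `|(f^`(k))%classic x| <= C).

Definition expi (R : realType) (t : R) : R[i] := cos t +i* sin t.

Definition complex_integral (R : realType) (g : R -> R[i]) : R[i] :=
  (\int[lebesgue_measure]_x complex.Re (g x))
  +i* (\int[lebesgue_measure]_x complex.Im (g x)).

Definition fourier (R : realType) (f : R -> R) (y : R) : R[i] :=
  complex_integral (fun x : R => (f x)%:C * expi (- (2 * pi * x * y))).

(* Meaningful only when [B] is eventually nonzero: in a field [x / 0 = 0]. *)
Definition asymptotic (K : numFieldType) (A B : nat -> K) : Prop :=
  (A n / B n) @[n --> \oo] --> (1 : K).

Definition pythagorean_mod (p n : nat) : set (int * int * int) :=
  [set x | let: (x1, x2, x3) := x in
    gcdz (x1 * x2 * x3) p%:Z = 1 /\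
    (x1 ^+ 2 + x2 ^+ 2 - x3 ^+ 2 = 0 %[mod p%:Z ^+ n])%Z].

(* The terms are meant to be nonnegative; [fine] would send an infinite sum
   to 0, but the sum is finite for every Schwartz [Phi >= 0] and [N > 0]. *)
Definition smooth_count (R : realType) (Phi : R -> R) (p n : nat) (N : R) : R :=
  fine (\esum_(x in pythagorean_mod p n)
    (Phi (x.1.1%:~R / N) * Phi (x.1.2%:~R / N) * Phi (x.2%:~R / N))%:E).

(* Used for odd primes only, so the second case is p = 1 mod 4. *)
Definition s (p : nat) : nat := (if p == 3 %[mod 4] then 3 else 5)%N.

(* Main.v *)
(** Average the indicator of the cone x1^2 + x2^2 = x3^2 modulo q = p^n over
    translates by k-fold sums of integers in [0, H), with H = q^(1/2 + delta), and
    expand in additive characters modulo q. The zero frequency gives the density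
    (p - s(p)) (p - 1) / (p^2 q). Large frequencies are negligible since the
    k-fold average decays fast. A frequency m of size less than
    q^(1/2 - delta) has a vanishing coefficient unless p^(n-1) divides
    m1^2 + m2^2 - m3^2, hence, by size, unless m1^2 + m2^2 = m3^2 in Z: scaling
    by units 1 + p s restricts the coefficient to points with p^(n-1) | m.x, and
    a translation along (m1, m2, -m3) then multiplies it by a nontrivial root of
    unity. There are O(X log X) such m of size at most X, each with coefficient
    about q^(3/2), which is negligible against q^2. So the averaged indicator is
    uniformly asymptotic to its density. As Phi is Lipschitz with Lipschitz
    constant decaying like 1 / (1 + x^2), replacing Phi(x / N) by its value at a
    translate by at most k H = o(N) changes the count by a negligible amount,
    and a Riemann sum finishes the proof. *)

Require Import Defs.
From HB Require Import structures.
From mathcomp Require Import all_boot all_order all_algebra.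
From mathcomp Require Import complex.
From mathcomp Require Import all_classical all_reals all_analysis.
From mathcomp Require Import measurable_realfun.
From mathcomp Require Import ring lra zify.
Import Order.TTheory GRing.Theory Num.Theory.
Import numFieldNormedType.Exports.
Local Open Scope classical_set_scope.
Local Open Scope ring_scope.
Local Open Scope complex_scope.

Set Implicit Arguments.
Unset Strict Implicit.

(** * Sums of periodic functions over residue classes *)

(** The exponent 1/2 is where the size argument closes: for frequencies below [p ^ (n / 2 - d)] the
    form takes values smaller than [p ^ n], so divisibility becomes an equation over the integers.
    The isotropic frequencies that survive are harmless only because they are few. Those divisible
    by [p ^ j] have coefficients larger by about [p ^ (j / 2)], but they are rarer by about [p ^ j],
    so the primitive ones dominate. An integer [D] with [3 / D <= nu - 1 / 2] plays the role of 1 /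
    delta. With [d = n %/ D], the frequency cut-off, the length [H] and the bound for [N] are spaced
    by factors [p ^ d], and every error gains such a factor. The transform of one interval decays
    only like the inverse frequency, too slowly for trivial bounds over [q ^ 3] frequencies.
    Convolving [k = 5 * D] times raises the gain [p ^ d] to about [q ^ 5]. All harmonic analysis is
    thus finite, modulo [q]; [Phi] enters only through nonnegative upper and lower envelopes. *)

Definition zperiodic (V : Type) (q : nat) (f : int -> V) :=
  forall x y : int, (q%:Z %| x - y)%Z -> f x = f y.

(** Residue classes are represented by the integers 0, ..., q - 1, and functions live on all of
    [int]. Polynomial identities are then proved in [int] by [ring], and invariance under a change
    of representative is the separate hypothesis [zperiodic]. *)
Definition psum (V : nmodType) (q : nat) (f : int -> V) : V :=
  \sum_(i < q) f i%:Z.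

Lemma eq_psum (V : nmodType) (q : nat) (f g : int -> V) :
  f =1 g -> psum q f = psum q g.
Proof. by move=> fg; apply: eq_bigr => i _; rewrite fg. Qed.

Lemma dvdz_ord_eq (q : nat) (i j : 'I_q) :
  (q%:Z %| i%:Z - j%:Z)%Z -> i = j.
Proof.
rewrite -eqz_mod_dvd !modz_nat => /eqP[].
by rewrite !modn_small // => ?; apply: val_inj.
Qed.

Lemma psum_affine (V : nmodType) (q : nat) (t c : int) (f : int -> V) :
  coprimez q t -> zperiodic q f ->
  psum q (fun x => f (t * x + c)) = psum q f.
Proof.
case: q => [|q] qt fP; first by rewrite /psum !big_ord0.
pose g (i : 'I_q.+1) : 'I_q.+1 := inord `|((t * i%:Z + c) %% q.+1%:Z)%Z|%N.
have gE i : (g i)%:Z = ((t * i%:Z + c) %% q.+1%:Z)%Z.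
  rewrite inordK; first by rewrite gez0_abs // modz_ge0.
  by rewrite -ltz_nat gez0_abs ?modz_ge0 // ltz_pmod.
have gP i : (q.+1%:Z %| (g i)%:Z - (t * i%:Z + c))%Z.
  by rewrite -eqz_mod_dvd gE modz_mod.
have ginj : injective g.
  move=> i j gij; apply: dvdz_ord_eq.
  rewrite -(Gauss_dvdzr _ qt).
  have -> : t * (i%:Z - j%:Z) =
    ((g j)%:Z - (t * j%:Z + c)) - ((g i)%:Z - (t * i%:Z + c)).
    by rewrite gij; ring.
  by rewrite rpredB.
rewrite /psum [RHS](reindex_inj ginj) /=; apply: eq_bigr => i _.
by apply/esym/fP.
Qed.

Lemma psum_shift (V : nmodType) (q : nat) (c : int) (f : int -> V) :
  zperiodic q f -> psum q (fun x => f (x + c)) = psum q f.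
Proof.
move=> fP; rewrite -[RHS](@psum_affine _ _ 1 c) ?coprimez1 //.
  by apply: eq_psum => x; rewrite mul1r.
by rewrite /coprimez gcdz1.
Qed.

Lemma psum_muln (V : nmodType) (a b : nat) (f : int -> V) :
  psum (a * b) f = psum a (fun y => psum b (fun x => f (x + y * b%:Z))).
Proof.
rewrite /psum -(big_mkord xpredT (fun i => f i%:Z)) big_nat_mul big_mkord.
apply: eq_bigr => i _.
rewrite mulSn addnC -{1}[(i * b)%N]add0n big_addn addnC addnK big_mkord.
by apply: eq_bigr => j _; rewrite PoszD PoszM.
Qed.

Lemma psum_mul_periodic (V : nmodType) (a b : nat) (f : int -> V) :
  zperiodic b f -> psum (a * b) f = psum b f *+ a.
Proof.
move=> fP; rewrite psum_muln.
have E (y : int) : psum b (fun x => f (x + y * b%:Z)) = psum b f.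
  apply: eq_psum => x; apply: fP.
  by rewrite addrAC subrr add0r dvdz_mull.
by rewrite {1}/psum (eq_bigr _ (fun i _ => E _)) sumr_const card_ord.
Qed.

Definition sum3 (V : nmodType) (q : nat) (f : int -> int -> int -> V) : V :=
  psum q (fun x => psum q (fun y => psum q (fun z => f x y z))).

Definition periodic3 (V : Type) (q : nat) (f : int -> int -> int -> V) :=
  forall x y z x' y' z' : int, (q%:Z %| x - x')%Z -> (q%:Z %| y - y')%Z ->
    (q%:Z %| z - z')%Z -> f x y z = f x' y' z'.

Lemma eq_sum3 (V : nmodType) (q : nat) (f g : int -> int -> int -> V) :
  (forall x y z, f x y z = g x y z) -> sum3 q f = sum3 q g.
Proof. by move=> fg; do 3![apply: eq_psum => ?]. Qed.

Lemma sum3_affine (V : nmodType) (q : nat) (t a b c : int)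
    (f : int -> int -> int -> V) :
  coprimez q t -> periodic3 q f ->
  sum3 q (fun x y z => f (t * x + a) (t * y + b) (t * z + c)) = sum3 q f.
Proof.
move=> qt fP.
transitivity (psum q (fun x => psum q (fun y => psum q (f (t * x + a) y)))).
  apply: eq_psum => x.
  transitivity (psum q (fun y => psum q (f (t * x + a) (t * y + b)))).
    apply: eq_psum => y.
    apply: (psum_affine (f := f (t * x + a) (t * y + b)) c qt) => z z' zz'.
    by apply: fP; rewrite ?subrr ?dvdz0.
  apply: (psum_affine (f := fun y => psum q (f (t * x + a) y)) b qt).
  move=> y y' yy'; apply: eq_psum => z.
  by apply: fP; rewrite ?subrr ?dvdz0.
apply: (psum_affine (f := fun x => psum q (fun y => psum q (f x y))) a qt).
move=> x x' xx'; do 2![apply: eq_psum => ?].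
by apply: fP; rewrite ?subrr ?dvdz0.
Qed.

Lemma sum3_shift (V : nmodType) (q : nat) (a b c : int)
    (f : int -> int -> int -> V) :
  periodic3 q f -> sum3 q (fun x y z => f (x + a) (y + b) (z + c)) = sum3 q f.
Proof.
move=> fP; rewrite -[RHS](@sum3_affine _ _ 1 a b c) //.
  by apply: eq_sum3 => x y z; rewrite !mul1r.
by rewrite /coprimez gcdz1.
Qed.

(** * Counting points on the cone modulo prime powers *)

Definition qf (x y z : int) : int := x ^+ 2 + y ^+ 2 - z ^+ 2.

Definition cone (p n : nat) (x y z : int) : bool :=
  [&& ~~ (p%:Z %| x)%Z, ~~ (p%:Z %| y)%Z, ~~ (p%:Z %| z)%Z
    & ((p ^ n)%N%:Z %| qf x y z)%Z].

Lemma dvdz_exists (d m : int) : (d %| m)%Z -> exists k, m = k * d.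
Proof. by case/dvdzP => k ->; exists k. Qed.

Lemma prime_dvdzM (p : nat) (a b : int) : prime p ->
  (p%:Z %| a * b)%Z = (p%:Z %| a)%Z || (p%:Z %| b)%Z.
Proof. by move=> pp; rewrite !dvdzE abszM Euclid_dvdM. Qed.

Lemma prime_coprimez (p : nat) (a : int) : prime p ->
  coprimez p a = ~~ (p%:Z %| a)%Z.
Proof. by move=> pp; rewrite coprimezE prime_coprime // dvdzE. Qed.

Lemma prime_coprimezX (p n : nat) (a : int) : prime p ->
  ~~ (p%:Z %| a)%Z -> coprimez (p ^ n)%N a.
Proof.
move=> pp pa; rewrite coprimezE /= coprimeXl //.
by rewrite prime_coprime //; move: pa; rewrite dvdzE.
Qed.

Lemma odd_prime_ndvdz2 (p : nat) : prime p -> (2 < p)%N -> ~~ (p%:Z %| 2%R)%Z.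
Proof.
move=> pp p2; apply/negP; rewrite dvdzE => /(dvdn_leq (isT : (0 < 2)%N)).
by rewrite leqNgt p2.
Qed.

Lemma dvdz_congr (d x y : int) : (d %| x - y)%Z -> (d %| x)%Z = (d %| y)%Z.
Proof.
move=> dxy; apply/idP/idP => h.
  have -> : y = x - (x - y) by ring.
  by rewrite rpredB.
have -> : x = (x - y) + y by ring.
by rewrite rpredD.
Qed.

Lemma cone_periodic (p n : nat) : (0 < n)%N -> periodic3 (p ^ n) (cone p n).
Proof.
move=> n0 x y z x' y' z' hx hy hz.
have pq : (p%:Z %| (p ^ n)%N%:Z)%Z by rewrite dvdzE dvdn_exp.
have dp := dvdz_trans pq; rewrite /cone.
rewrite (dvdz_congr (dp _ hx)) (dvdz_congr (dp _ hy)) (dvdz_congr (dp _ hz)).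
rewrite (@dvdz_congr _ (qf x y z) (qf x' y' z')) //.
have -> : qf x y z - qf x' y' z' =
    (x + x') * (x - x') + (y + y') * (y - y') - (z + z') * (z - z').
  by rewrite /qf; ring.
by rewrite rpredB ?rpredD ?dvdz_mull.
Qed.

Lemma psum_delta (K : pzSemiRingType) (q : nat) (a : int) (f : int -> K) :
  (0 < q)%N -> zperiodic q f ->
  psum q (fun y => (q%:Z %| y - a)%Z%:R * f y) = f a.
Proof.
move=> q0 fP.
rewrite -(@psum_shift _ _ a); last first.
  move=> x y xy; rewrite (fP _ _ xy) (@dvdz_congr _ (x - a) (y - a)) //.
  by have -> : x - a - (y - a) = x - y by ring.
case: q q0 fP => // q _ fP.
rewrite /psum big_ord_recl /= addrK dvdz0 mul1r big1 ?addr0 ?add0r // => i _.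
by rewrite addrK dvdzE /= gtnNdvd ?mul0r // ltnS.
Qed.

Lemma psum_dvd_affine (K : pzSemiRingType) (q : nat) (t c : int) :
  (0 < q)%N -> coprimez q t ->
  psum q (fun y => (q%:Z %| t * y + c)%Z%:R : K) = 1.
Proof.
move=> q0 qt; rewrite (@psum_affine _ q t c (fun y => (q%:Z %| y)%Z%:R)) //.
  rewrite -[RHS](@psum_delta K q 0 (fun=> 1)) //.
  by apply: eq_psum => y; rewrite subr0 mulr1.
by move=> x y xy; rewrite (dvdz_congr xy).
Qed.

Lemma psum_sum (V : nmodType) (I : finType) (q : nat) (f : I -> int -> V) :
  psum q (fun x => \sum_i f i x) = \sum_i psum q (f i).
Proof. exact: exchange_big. Qed.

Lemma sum3_sum (V : nmodType) (I : finType) (q : nat)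
    (f : I -> int -> int -> int -> V) :
  sum3 q (fun x y z => \sum_i f i x y z) = \sum_i sum3 q (f i).
Proof.
rewrite -psum_sum; apply: eq_psum => x; rewrite -psum_sum.
by apply: eq_psum => y; rewrite -psum_sum.
Qed.

Lemma sum3_mul_periodic (V : nmodType) (a b : nat)
    (f : int -> int -> int -> V) :
  periodic3 b f -> sum3 (a * b) f = sum3 b f *+ (a ^ 3).
Proof.
move=> fP.
have fP1 x y : zperiodic b (f x y) by move=> z z' ?; apply: fP; rewrite ?subrr.
have fP2 x : zperiodic b (fun y => psum b (f x y)).
  by move=> y y' ?; apply: eq_psum => z; apply: fP; rewrite ?subrr.
have fP3 : zperiodic b (fun x => psum b (fun y => psum b (f x y))).
  by move=> x x' ?; do 2![apply: eq_psum => ?]; apply: fP; rewrite ?subrr.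
rewrite /sum3 (_ : psum (a * b) _ =
  psum (a * b) (fun x => psum b (fun y => psum b (f x y))) *+ (a * a)).
  by rewrite psum_mul_periodic // -mulrnA expnS mulnC -mulnA.
rewrite /psum -sumrMnl; apply: eq_bigr => i _; rewrite mulrnA.
rewrite -(psum_mul_periodic _ (fP2 i%:Z)) /psum -sumrMnl; apply: eq_bigr => j _.
by rewrite -(psum_mul_periodic _ (fP1 i%:Z j%:Z)).
Qed.

(** Hensel lifting in the first coordinate. If [qf x y z = c * p ^ n], the translate has value
    [p ^ n * (2 * x * t + c)] up to a multiple of [p ^ (2 * n)]. As [2 * x] is a unit modulo [p],
    exactly one [t] makes the bracket divisible by [p]. *)
Lemma cone_lift (K : pzSemiRingType) (p n : nat) (x y z : int) :
  prime p -> (2 < p)%N -> (0 < n)%N ->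
  \sum_(t < p) (cone p n.+1 (x + (p ^ n)%N%:Z * t%:Z) y z)%:R =
  (cone p n x y z)%:R :> K.
Proof.
move=> pp p2 n0.
have pq : (p%:Z %| (p ^ n)%N%:Z)%Z by rewrite dvdzE dvdn_exp.
have q0 : (p ^ n)%N%:Z != 0 by rewrite eqz_nat -lt0n expn_gt0 prime_gt0.
have qq : ((p ^ n)%N%:Z %| (p ^ n.+1)%N%:Z)%Z by rewrite dvdzE dvdn_exp2l.
have coneS (t : int) : cone p n.+1 (x + (p ^ n)%N%:Z * t) y z -> cone p n x y z.
  case/and4P => ux uy uz Q.
  rewrite (@cone_periodic p n n0 _ y z (x + (p ^ n)%N%:Z * t) y z) ?subrr //.
    by rewrite /cone ux uy uz (dvdz_trans qq).
  have -> : x - (x + (p ^ n)%N%:Z * t) = - t * (p ^ n)%N%:Z by ring.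
  by rewrite dvdz_mull.
case: (boolP (cone p n x y z)) => [/and4P[ux uy uz]|h]; last first.
  by apply: big1 => t _; rewrite (contraNF (@coneS t%:Z) h).
case/dvdz_exists => c Qc.
rewrite -[RHS](@psum_dvd_affine K p (2 * x) c (prime_gt0 pp)); last first.
  by rewrite prime_coprimez // prime_dvdzM // negb_or odd_prime_ndvdz2.
apply: eq_bigr => t _; congr (_%:R); congr nat_of_bool.
rewrite /cone uy uz (@dvdz_congr p (x + _) x) ?ux /=; last first.
  have -> : x + (p ^ n)%N%:Z * t%:Z - x = t%:Z * (p ^ n)%N%:Z by ring.
  by rewrite dvdz_mull.
have -> : qf (x + (p ^ n)%N%:Z * t%:Z) y z =
  (p ^ n)%N%:Z * (2 * x * t%:Z + c + t%:Z ^+ 2 * (p ^ n)%N%:Z).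
  move: Qc; rewrite /qf => Qc.
  transitivity (x ^+ 2 + y ^+ 2 - z ^+ 2 +
    (p ^ n)%N%:Z * (2 * x * t%:Z + t%:Z ^+ 2 * (p ^ n)%N%:Z)); first by ring.
  by rewrite Qc; ring.
rewrite expnSr PoszM dvdz_mul2l //=.
apply: dvdz_congr; rewrite addrAC subrr add0r.
by rewrite dvdz_mull.
Qed.

Definition ncone (K : pzSemiRingType) (p n : nat) : K :=
  sum3 (p ^ n) (fun x y z => (cone p n x y z)%:R).

(* Averaging over the translates [x + p ^ n * t] of the first coordinate, of
   which exactly one lies on the cone modulo [p ^ n.+1]. *)
Lemma ncone_rec (K : numDomainType) (p n : nat) :
  prime p -> (2 < p)%N -> (0 < n)%N ->
  ncone K p n.+1 = p%:R ^+ 2 * ncone K p n.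
Proof.
move=> pp p2 n0.
have p0 : p%:R != 0 :> K by rewrite pnatr_eq0 -lt0n prime_gt0.
apply: (mulfI p0); rewrite mulrA -exprS.
have coneP m : (0 < m)%N ->
    periodic3 (p ^ m) (fun x y z => (cone p m x y z)%:R : K).
  by move=> m0 x y z x' y' z' hx hy hz; rewrite (cone_periodic m0 hx hy hz).
transitivity (\sum_(t < p) sum3 (p ^ n.+1)
    (fun x y z => (cone p n.+1 (x + (p ^ n)%N%:Z * t%:Z) y z)%:R : K)).
  rewrite (eq_bigr (fun=> ncone K p n.+1)); last first.
    move=> t _; rewrite /ncone.
    rewrite -(sum3_shift ((p ^ n)%N%:Z * t%:Z) 0 0 (coneP _ (ltn0Sn n))).
    by apply: eq_sum3 => x y z; rewrite !addr0.
  by rewrite sumr_const card_ord mulr_natl.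
rewrite -sum3_sum (eq_sum3 _ (fun x y z => cone_lift K x y z pp p2 n0)).
rewrite expnS sum3_mul_periodic; last exact: coneP.
by rewrite -[LHS]mulr_natl natrX.
Qed.

Lemma psumM (K : pzSemiRingType) (q : nat) (a : K) (f : int -> K) :
  psum q (fun x => a * f x) = a * psum q f.
Proof. by rewrite /psum mulr_sumr. Qed.

Lemma exchange_psum (V : nmodType) (a b : nat) (f : int -> int -> V) :
  psum a (fun x => psum b (f x)) = psum b (fun y => psum a (f^~ y)).
Proof. exact: exchange_big. Qed.

Lemma psum_cst (V : nmodType) (q : nat) (v : V) : psum q (fun=> v) = v *+ q.
Proof. by rewrite /psum sumr_const card_ord. Qed.

(* Wilson's theorem with the first [m] factors replaced by their opposites. *)
Lemma fact_symm_mod (p m : nat) : prime p -> (m < p)%N ->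
  (p%:Z %| (m`! * (p.-1 - m)`!)%N%:Z + (-1) ^+ m)%Z.
Proof.
move=> pp; elim: m => [_|m IHm mp].
  have := Wilson (prime_gt1 pp); rewrite pp subn0 fact0 mul1n expr0 => /esym.
  by rewrite dvdzE /= addn1.
have {IHm} := IHm (ltnW mp).
have E : ((p.-1 - m) = (p.-1 - m.+1).+1)%N by lia.
set A := (m`! * (p.-1 - m.+1)`!)%N%:Z.
have -> : (m`! * (p.-1 - m)`!)%N%:Z = (p%:Z - m.+1%:Z) * A.
  by rewrite E factS /A !PoszM; have -> : (p.-1 - m.+1).+1%:Z = p%:Z - m.+1%:Z;
    [lia | ring].
have -> : (m.+1`! * (p.-1 - m.+1)`!)%N%:Z = m.+1%:Z * A.
  by rewrite factS /A !PoszM mulrA.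
move=> h; have -> : m.+1%:Z * A + (-1) ^+ m.+1 =
    A * p%:Z - ((p%:Z - m.+1%:Z) * A + (-1) ^+ m) by rewrite exprS; ring.
by rewrite rpredB // dvdz_mull.
Qed.

Lemma sqrt_m1_mod (p : nat) : prime p -> (p %% 4 = 1)%N ->
  exists i : int, (p%:Z %| i ^+ 2 + 1)%Z.
Proof.
move=> pp p4; have pE : (p = (p %/ 4) * 4 + 1)%N by rewrite {1}(divn_eq p 4) p4.
(* For [p = 4 * k + 1], the symmetric form of Wilson's theorem at its midpoint [m = 2 * k] says that
   the square of [(2 * k)!] is -1. *)
move: (p %/ 4)%N pE => k pE; exists ((2 * k)`!%:Z).
have /= := @fact_symm_mod p (2 * k) pp; rewrite pE.
have -> : ((k * 4 + 1).-1 - 2 * k = 2 * k)%N by lia.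
rewrite exprM sqrrN !expr1n PoszM -expr2; apply; lia.
Qed.

(** If [i ^ 2 = -1] modulo [p = 4 * k + 3], raising to the odd power [2 * k + 1] gives
    [i ^ (p - 1) = -1]. Fermat gives 1, so [p] would divide 2. *)
Lemma no_sqrt_m1_mod (p : nat) (i : int) : prime p -> (p %% 4 = 3)%N ->
  ~~ (p%:Z %| i ^+ 2 + 1)%Z.
Proof.
move=> pp p4; apply/negP => h.
have pE : (p = (p %/ 4) * 4 + 3)%N by rewrite {1}(divn_eq p 4) p4.
move: (p %/ 4)%N pE => k pE.
have p2 : (2 < p)%N by lia.
have hn : (p%:Z %| (`|i| ^ 2)%N%:Z + 1)%Z.
  have -> : (`|i| ^ 2)%N%:Z = i ^+ 2 by rewrite -abszX gez0_abs // sqr_ge0.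
  by [].
set a := `|i|%N in hn.
have ua : ~~ (p%:Z %| a%:Z)%Z.
  apply/negP => pa; have : (p%:Z %| 1%R)%Z.
    have -> : 1 = (a ^ 2)%N%:Z + 1 - a%:Z * a%:Z by rewrite expnS expn1 PoszM; ring.
    by rewrite rpredB // dvdz_mull.
  by rewrite dvdzE /= dvdn1; move: p2; case: (p) => [|[|]].
have f1 : (p%:Z %| a%:Z ^+ p.-1 - 1)%Z.
  have := fermat_little a pp => /eqP; rewrite -eqz_nat -!modz_nat => /eqP.
  move/eqP; rewrite eqz_mod_dvd; rewrite -{1}(prednK (prime_gt0 pp)).
  have -> : (a ^ p.-1.+1)%N%:Z - a%:Z = a%:Z * (a%:Z ^+ p.-1 - 1).
    by rewrite expnS PoszM -rmorphXn /=; ring.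
  by rewrite prime_dvdzM // (negbTE ua).
have f2 : (p%:Z %| a%:Z ^+ p.-1 + 1)%Z.
  have -> : (p.-1 = 2 * (2 * k).+1)%N by clear -pE; lia.
  rewrite exprM; set b := a%:Z ^+ 2.
  have hb : (p%:Z %| b + 1)%Z by move: hn; rewrite expnS expn1 PoszM -expr2.
  have -> : b ^+ (2 * k).+1 + 1 = b ^+ (2 * k).+1 - (-1) ^+ (2 * k).+1.
    by rewrite [(-1) ^+ _]exprS (exprM (-1)) sqrrN !expr1n mulr1 opprK.
  by rewrite subrXX opprK dvdz_mulr.
have := odd_prime_ndvdz2 pp p2; apply/negP/negPn.
have -> : 2 = (a%:Z ^+ p.-1 + 1) - (a%:Z ^+ p.-1 - 1) by ring.
by rewrite rpredB.
Qed.

Lemma psum_unit (K : pzRingType) (p : nat) : prime p ->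
  psum p (fun x => (~~ (p%:Z %| x)%Z)%:R) = p%:R - 1 :> K.
Proof.
move=> pp; apply/eqP; rewrite eq_sym subr_eq; apply/eqP.
rewrite -[X in _ = _ + X](@psum_dvd_affine K p 1 0 (prime_gt0 pp)).
  rewrite /psum -big_split /= -[LHS](psum_cst p (1 : K)).
  by apply: eq_bigr => i _; rewrite mul1r addr0; case: (_ \in _) => /=;
    rewrite ?addr0 ?add0r.
by rewrite /coprimez gcdz1.
Qed.

Lemma psum_eq_or (K : pzRingType) (p : nat) (a : int) : prime p ->
  ~~ (p%:Z %| 2 * a)%Z ->
  psum p (fun t => (p%:Z %| t ^+ 2 - a ^+ 2)%Z%:R) = 2 :> K.
Proof.
move=> pp pa.
have p1 : coprimez p 1 by rewrite /coprimez gcdz1.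
have <- : psum p (fun t => (p%:Z %| 1 * t + a)%Z%:R) +
    psum p (fun t => (p%:Z %| 1 * t + (- a))%Z%:R) = 2 :> K.
  by rewrite !psum_dvd_affine ?prime_gt0.
rewrite /psum -big_split /=; apply: eq_bigr => t _.
rewrite !mul1r.
have -> : t%:Z ^+ 2 - a ^+ 2 = (t%:Z + a) * (t%:Z + - a) by ring.
rewrite prime_dvdzM //.
case: (boolP (p%:Z %| t%:Z + a)%Z) => h1; last by rewrite add0r.
case: (boolP (p%:Z %| t%:Z + - a)%Z) => h2; last by rewrite addr0.
case/negP: pa; have -> : 2 * a = (t%:Z + a) - (t%:Z + - a) by ring.
by rewrite rpredB.
Qed.

(** This is where [s p] comes from: the excluded parameters are 0, the two square roots of 1, and
    the square roots of -1, of which there are two or none according to [p] modulo 4. The three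
    conditions exclude one another because [p] divides neither 1 nor 2. *)
Lemma psum_param (K : pzRingType) (p : nat) : prime p -> (5 < p)%N ->
  psum p (fun t => [&& ~~ (p%:Z %| t)%Z, ~~ (p%:Z %| t ^+ 2 - 1)%Z
     & ~~ (p%:Z %| t ^+ 2 + 1)%Z]%:R) = p%:R - (s p)%:R :> K.
Proof.
move=> pp p5.
have p2 : (2 < p)%N by lia.
have u2 := odd_prime_ndvdz2 pp p2.
have u1 : ~~ (p%:Z %| 1%R)%Z by rewrite dvdzE /= dvdn1; apply/eqP => ?; lia.
have p1 : coprimez p 1 by rewrite /coprimez gcdz1.
set S := psum _ _.
have E1 : psum p (fun t => (p%:Z %| 1 * t + 0)%Z%:R) = 1 :> K.
  by rewrite psum_dvd_affine ?prime_gt0.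
have E2 : psum p (fun t => (p%:Z %| t ^+ 2 - 1 ^+ 2)%Z%:R) = 2 :> K.
  by rewrite psum_eq_or // mulr1.
have E3 : psum p (fun t => (p%:Z %| t ^+ 2 + 1)%Z%:R) = (s p - 3)%:R :> K.
  rewrite /s; case: ifPn => [/eqP p4|np4].
    by apply: big1 => t _; rewrite (negbTE (no_sqrt_m1_mod _ pp _)) // p4.
  have p4 : (p %% 4 = 1)%N.
    have [|op] := even_prime pp; first by lia.
    by move: np4; rewrite (_ : 3 %% 4 = 3)%N // => /eqP np4; lia.
  have [i hi] := sqrt_m1_mod pp p4.
  have ui : ~~ (p%:Z %| i)%Z.
    apply: contraNN u1 => pi; have -> : 1 = (i ^+ 2 + 1) - i * i by ring.
    by rewrite rpredB // dvdz_mull.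
  rewrite -[RHS](@psum_eq_or K p i) //; last first.
    by rewrite prime_dvdzM // negb_or u2.
  apply: eq_psum => t; congr (_%:R); congr nat_of_bool.
  apply: dvdz_congr; have -> : t ^+ 2 + 1 - (t ^+ 2 - i ^+ 2) = i ^+ 2 + 1 by ring.
  by [].
have E : S + (1 + 2 + (s p - 3)%:R) = p%:R.
  rewrite -{1}E1 -{1}E2 -E3 /S /psum -!big_split /=.
  rewrite -[RHS](psum_cst p (1 : K)); apply: eq_bigr => t _.
  rewrite mul1r addr0 expr1n.
  have a1 : (p%:Z %| t%:Z)%Z -> ~~ (p%:Z %| t%:Z ^+ 2 - 1)%Z.
    move=> h; apply: contraNN u1 => h'.
    have -> : 1 = t%:Z * t%:Z - (t%:Z ^+ 2 - 1) by ring.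
    by rewrite rpredB // dvdz_mull.
  have a2 : (p%:Z %| t%:Z)%Z -> ~~ (p%:Z %| t%:Z ^+ 2 + 1)%Z.
    move=> h; apply: contraNN u1 => h'.
    have -> : 1 = (t%:Z ^+ 2 + 1) - t%:Z * t%:Z by ring.
    by rewrite rpredB // dvdz_mull.
  have a3 : (p%:Z %| t%:Z ^+ 2 - 1)%Z -> ~~ (p%:Z %| t%:Z ^+ 2 + 1)%Z.
    move=> h; apply: contraNN u2 => h'.
    have -> : 2 = (t%:Z ^+ 2 + 1) - (t%:Z ^+ 2 - 1) by ring.
    by rewrite rpredB.
  move: a1 a2 a3.
  case: (p%:Z %| t%:Z)%Z; case: (p%:Z %| t%:Z ^+ 2 - 1)%Z;
  case: (p%:Z %| t%:Z ^+ 2 + 1)%Z => //= h1 h2 h3; rewrite ?addr0 ?add0r //.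
  - by have := h1 isT.
  - by have := h1 isT.
  - by have := h2 isT.
  - by have := h3 isT.
apply/eqP; rewrite eq_sym subr_eq -E; apply/eqP; congr (_ + _).
rewrite -[1]/(1%:R) -!natrD; congr (_%:R).
by rewrite /s; case: ifP.
Qed.

(* With [z = u + y], [x = u * t] and [y = w * u * y'], where [2 * w = 1] modulo
   [p], the equation becomes [y' = t ^ 2 - 1] and [u] is free. *)
Lemma ncone1 (K : comPzRingType) (p : nat) : prime p -> (5 < p)%N ->
  ncone K p 1 = (p%:R - 1) * (p%:R - (s p)%:R).
Proof.
move=> pp p5; have p2 : (2 < p)%N by lia.
have u2 := odd_prime_ndvdz2 pp p2.
have [|op] := even_prime pp; first by lia.
pose w : int := (p.+1./2)%:Z.
have w2 : 2 * w = 1 + p%:Z by rewrite /w; lia.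
have uw : ~~ (p%:Z %| w)%Z.
  apply/negP => h; have : (p%:Z %| 1%R)%Z.
    have -> : 1 = 2 * w - p%:Z by rewrite w2; ring.
    by rewrite rpredB // dvdz_mull.
  by rewrite dvdzE /= dvdn1; apply/negP/eqP; lia.
have cP : periodic3 p (fun x y z => (cone p 1 x y z)%:R : K).
  move=> x y z x' y' z' hx hy hz.
  by rewrite (@cone_periodic p 1 _ x y z x' y' z') ?expn1.
rewrite /ncone expn1 /sum3.
transitivity (psum p (fun u => psum p (fun y => psum p (fun x =>
    (cone p 1 x y (u + y))%:R : K)))).
  transitivity (psum p (fun x => psum p (fun u => psum p (fun y =>
      (cone p 1 x y (u + y))%:R : K)))); last first.
    rewrite exchange_psum; apply: eq_psum => u.
    by rewrite exchange_psum.
  apply: eq_psum => x; rewrite [RHS]exchange_psum; apply: eq_psum => y.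
  rewrite (psum_shift y (f := fun z => (cone p 1 x y z)%:R : K)) //.
  by move=> z z' zz'; apply: cP; rewrite ?subrr.
rewrite -psum_param // -(psum_unit _ pp) [RHS]mulrC -psumM.
apply: eq_psum => u.
case: (boolP (p%:Z %| u)%Z) => /= pu.
  (* When [p] divides [u], the second and third coordinates agree modulo [p], so the equation forces
     [p] to divide the square of the first coordinate, which must be a unit. *)
  rewrite mulr0 /psum; apply: big1 => i _; apply: big1 => j _.
  rewrite /cone [qf _ _ _](_ : _ = j%:Z ^+ 2 - (u + 2 * i%:Z) * u); last first.
    by rewrite /qf; ring.
  rewrite expn1 (@dvdz_congr _ (_ - _) (j%:Z ^+ 2)); last first.
    rewrite addrAC subrr add0r rpredN dvdz_mull //.
  by rewrite expr2 prime_dvdzM // orbb; case: (p%:Z %| j%:Z)%Z; rewrite /= ?andbF.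
rewrite mulr1.
transitivity (psum p (fun y => psum p (fun t =>
    (cone p 1 (u * t + 0) (w * u * y + 0) (u + (w * u * y + 0)))%:R : K))).
  transitivity (psum p (fun y => psum p (fun x =>
      (cone p 1 x (w * u * y + 0) (u + (w * u * y + 0)))%:R : K))).
    rewrite (psum_affine 0 (t := w * u) (f := fun y => psum p (fun x =>
      (cone p 1 x y (u + y))%:R : K))) //.
      by rewrite prime_coprimez // prime_dvdzM // negb_or uw.
    move=> y y' yy'; apply: eq_psum => x; apply: cP; rewrite ?subrr //.
    by rewrite [X in (_ %| X)%Z](_ : _ = y - y') //; ring.
  apply: eq_psum => y.
  rewrite (psum_affine 0 (t := u) (f := fun x =>
      (cone p 1 x (w * u * y + 0) (u + (w * u * y + 0)))%:R : K)) //.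
    by rewrite prime_coprimez.
  by move=> x x' xx'; apply: cP; rewrite ?subrr.
rewrite exchange_psum; apply: eq_psum => t.
(* [g] collects the unit conditions: in the new variables the third coordinate is congruent to
   [w * u * (y + 2)]. The equation itself becomes the delta function at [t ^ 2 - 1]. *)
pose g (y : int) : K := [&& ~~ (p%:Z %| t)%Z, ~~ (p%:Z %| y)%Z
     & ~~ (p%:Z %| y + 2)%Z]%:R.
have gP : zperiodic p g.
  move=> y y' yy'; rewrite /g (dvdz_congr yy') (@dvdz_congr _ (y + 2) (y' + 2)) //.
  by rewrite [X in (_ %| X)%Z](_ : _ = y - y') //; ring.
transitivity (psum p (fun y => (p%:Z %| y - (t ^+ 2 - 1))%Z%:R * g y)).
  apply: eq_psum => y; rewrite /g -natrM mulnb; congr (_%:R); congr nat_of_bool.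
  rewrite /cone expn1 !addr0 !prime_dvdzM // (negbTE pu) (negbTE uw) /=.
  rewrite (@dvdz_congr _ (u + w * u * y) (w * (u * (y + 2)))); last first.
    rewrite [X in (_ %| X)%Z](_ : _ = - (2 * w - 1) * u).
      by rewrite w2 addrAC subrr add0r mulNr rpredN dvdz_mulr.
    by ring.
  rewrite !prime_dvdzM // (negbTE pu) (negbTE uw) /=.
  rewrite (@dvdz_congr _ (qf _ _ _) (- (u * (u * (y - (t ^+ 2 - 1)))))); last first.
    rewrite [X in (_ %| X)%Z](_ : _ = - (2 * w - 1) * (u * u * y)).
      by rewrite w2 addrAC subrr add0r mulNr rpredN dvdz_mulr.
    by rewrite /qf; ring.
  rewrite rpredN !prime_dvdzM // (negbTE pu) /=.
  case: (p%:Z %| t)%Z; case: (p%:Z %| y)%Z; case: (p%:Z %| y + 2)%Z;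
  by case: (p%:Z %| y - (t ^+ 2 - 1))%Z.
rewrite psum_delta ?prime_gt0 // /g.
by have -> : t ^+ 2 - 1 + 2 = t ^+ 2 + 1 by ring.
Qed.

Lemma ncone_eq (K : numDomainType) (p n : nat) :
  prime p -> (5 < p)%N ->
  ncone K p n.+1 = (p%:R - 1) * (p%:R - (s p)%:R) * p%:R ^+ (2 * n).
Proof.
move=> pp p5; elim: n => [|n IHn]; first by rewrite ncone1 // muln0 expr0 mulr1.
rewrite ncone_rec //; last by lia.
by rewrite IHn mulnS exprD; ring.
Qed.

(** * Additive characters *)

Lemma expiD (R : realType) (a b : R) : expi (a + b) = expi a * expi b.
Proof.
rewrite /expi cosD sinD; apply/eqP; rewrite eq_complex /= eqxx /=.
by apply/eqP; ring.
Qed.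

Lemma expi0 (R : realType) : expi (0 : R) = 1.
Proof. by rewrite /expi cos0 sin0. Qed.

Lemma expi2pi (R : realType) : expi (2 * pi : R) = 1.
Proof. by rewrite /expi mulr_natl cos2pi sin2pi. Qed.

Lemma normr_expi (R : realType) (t : R) : `|expi t| = 1.
Proof. by rewrite normc_def /= cos2Dsin2 sqrtr1. Qed.

(* Doubling the angle at most doubles [|1 - expi t|]; once the angle reaches
   [pi / 2] the real part of [1 - expi t] is at least [1]. *)
Lemma norm_1Bexpi_ge (R : realType) (i : nat) (t : R) :
  pi <= 2 ^+ i * t -> t <= pi -> 1 <= 2 ^+ i * `|1 - expi t|.
Proof.
elim: i t => [|i IHi] t h1 h2.
  rewrite expr0 mul1r in h1; have -> : t = pi by apply/eqP; rewrite eq_le h1 h2.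
  rewrite expr0 mul1r /expi cospi sinpi complexr0 rmorphN1 opprK.
  by rewrite -mulr2n normr_nat ler1n.
have [tp|tp] := lerP (pi / 2) t.
  apply: (@le_trans _ _ `|1 - expi t|); last first.
    by rewrite ler_peMl // exprn_ege1 // ler1n.
  apply: le_trans (normc_ge_Re _); rewrite -[1]/(1%:C) lecR /=.
  have ct : cos t <= 0.
    have -> : t = (t - pi / 2) + pi / 2 by rewrite subrK.
    rewrite cosDpihalf oppr_le0 sin_ge0_pi // subr_ge0 tp /=.
    have := pi_gt0 R; lra.
  by rewrite ger0_norm; lra.
have {}IHi := IHi (2 * t).
have /IHi H : pi <= 2 ^+ i * (2 * t) by rewrite mulrA -exprSr.
have {}H : 1 <= 2 ^+ i * `|1 - expi (2 * t)|.
  by apply: H; rewrite mulrC -ler_pdivlMr // ltW.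
apply: le_trans H _; rewrite exprSr -mulrA ler_wpM2l ?exprn_ge0 //.
have -> : 1 - expi (2 * t) = (1 - expi t) * (1 + expi t).
  by rewrite (_ : 2 * t = t + t) ?expiD; ring.
rewrite normrM mulrC ler_wpM2r //.
by rewrite (le_trans (ler_normD _ _)) // normr1 normr_expi.
Qed.

Definition zchar (R : realType) (q : nat) (k : int) : R[i] :=
  expi (2 * pi * k%:~R / q%:R).

Lemma zcharD (R : realType) (q : nat) (k l : int) :
  zchar R q (k + l) = zchar R q k * zchar R q l.
Proof. by rewrite /zchar -expiD rmorphD /= mulrDr mulrDl. Qed.

Lemma zchar0 (R : realType) (q : nat) : zchar R q 0 = 1.
Proof. by rewrite /zchar mulr0 mul0r expi0. Qed.

Lemma zcharN (R : realType) (q : nat) (k : int) :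
  zchar R q k * zchar R q (- k) = 1.
Proof. by rewrite -zcharD subrr zchar0. Qed.

Lemma normr_zchar (R : realType) (q : nat) (k : int) : `|zchar R q k| = 1.
Proof. exact: normr_expi. Qed.

Lemma zcharMn (R : realType) (q : nat) (k : int) (n : nat) :
  zchar R q (k * n%:Z) = zchar R q k ^+ n.
Proof.
elim: n => [|n IHn]; first by rewrite mulr0 zchar0.
by rewrite exprS -IHn -zcharD; congr zchar; rewrite -addn1 PoszD; ring.
Qed.

Lemma zchar_self (R : realType) (q : nat) : (0 < q)%N -> zchar R q q%:Z = 1.
Proof.
move=> q0; rewrite /zchar mulfK; first exact: expi2pi.
by rewrite pnatr_eq0 -lt0n.
Qed.

Lemma zchar_dvd (R : realType) (q : nat) (k : int) : (0 < q)%N ->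
  (q%:Z %| k)%Z -> zchar R q k = 1.
Proof.
move=> q0 /dvdz_exists [c ->]; rewrite mulrC.
have E (n : nat) : zchar R q (q%:Z * n%:Z) = 1 by rewrite zcharMn zchar_self ?expr1n.
have [c0|/ltW c0] := lerP 0 c; first by rewrite -[c]gez0_abs.
by have := zcharN R q (q%:Z * c); rewrite -mulrN -(lez0_abs c0) E mulr1.
Qed.

Lemma zchar_periodic (R : realType) (q : nat) : (0 < q)%N ->
  zperiodic q (zchar R q).
Proof.
move=> q0 x y xy; have -> : x = (x - y) + y by ring.
by rewrite zcharD zchar_dvd // mul1r.
Qed.

(** A dyadic substitute for the bound of |1 - exp(2 pi i k / q)| below by a multiple of [|k| / q].
    Negative [k] reduce to positive ones on multiplying by a number of modulus 1. *)
Lemma norm_1Bzchar_ge (R : realType) (q i : nat) (k : int) : (0 < q)%N ->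
  (2 * `|k| <= q)%N -> (q <= 2 ^ i.+1 * `|k|)%N ->
  1 <= 2 ^+ i * `|1 - zchar R q k|.
Proof.
move=> q0; wlog k0 : k / 0 <= k.
  move=> wl; have [/wl//|/ltW k0] := lerP 0 k; rewrite -abszN => h1 h2.
  have {wl} /= := wl (- k); rewrite oppr_ge0 => /(_ k0 h1 h2).
  suff -> : `|1 - zchar R q (- k)| = `|1 - zchar R q k| by [].
  transitivity (`|zchar R q k| * `|1 - zchar R q (- k)|).
    by rewrite normr_zchar mul1r.
  rewrite -normrM mulrBr mulr1 zcharN.
  by rewrite distrC.
move=> h1 h2; apply: norm_1Bexpi_ge.
  rewrite mulrA ler_pdivlMr ?ltr0n // -[in leRHS](gez0_abs k0).
  have : (q%:R : R) <= (2 ^ i.+1 * `|k|)%:R by rewrite ler_nat.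
  rewrite natrM natrX exprSr => h; rewrite -pmulrn.
  have -> : 2 ^+ i * (2 * pi * `|k|%:R) = pi * (2 ^+ i * 2 * `|k|%:R) :> R by ring.
  by rewrite ler_wpM2l // pi_ge0.
rewrite ler_pdivrMr ?ltr0n // -(gez0_abs k0) -pmulrn.
have : ((2 * `|k|)%:R : R) <= q%:R by rewrite ler_nat.
rewrite natrM => h; have -> : 2 * pi * `|k|%:R = pi * (2 * `|k|%:R) :> R by ring.
by rewrite ler_wpM2l // pi_ge0.
Qed.

(** A representative [r] of [k] with [2 * |r| <= q] is either 0 or subject to the lower bound for
    [|1 - zchar R q r|]; the exponent [i = q] is crude but always admissible. *)
Lemma zchar_eq1 (R : realType) (q : nat) (k : int) : (0 < q)%N ->
  zchar R q k = 1 -> (q%:Z %| k)%Z.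
Proof.
move=> q0 k1.
have [r rk r2] : exists2 r : int, (q%:Z %| k - r)%Z & (2 * `|r| <= q)%N.
  have q0' : 0 < q%:Z by rewrite ltz_nat.
  have h1 := ltz_pmod k q0'; have h0 : 0 <= (k %% q%:Z)%Z.
    by rewrite modz_ge0 // eqz_nat -lt0n.
  have hq := divz_eq k q%:Z.
  have [h|h] := lerP (2 * (k %% q%:Z)%Z) q%:Z.
    exists (k %% q%:Z)%Z; last by lia.
    rewrite {1}hq addrK; exact: dvdz_mull.
  exists ((k %% q%:Z)%Z - q%:Z); last by lia.
  by rewrite {1}hq opprB addrA addrAC addrK addrC rpredD ?dvdz_mull.
rewrite (dvdz_congr rk).
have {}k1 : zchar R q r = 1 by rewrite -(zchar_periodic R q0 rk).
apply/negPn/negP => qr.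
have r0 : (0 < `|r|)%N by rewrite absz_gt0; apply: contraNneq qr => ->.
have := @norm_1Bzchar_ge R q q r q0 r2.
rewrite k1 subrr normr0 mulr0 ler10 => h; apply/notF/h.
apply: leq_trans (leq_pmulr _ r0).
by rewrite (leq_trans (ltnW (ltn_expl q (isT : (1 < 2)%N)))) // leq_exp2l.
Qed.

Lemma psum_zchar (R : realType) (q : nat) (l : int) : (0 < q)%N ->
  psum q (fun x => zchar R q (l * x)) = if (q%:Z %| l)%Z then q%:R else 0.
Proof.
move=> q0; case: ifPn => ql.
  rewrite -[RHS](psum_cst q (1 : R[i])); apply: eq_psum => x.
  by rewrite zchar_dvd // dvdz_mulr.
have P : zperiodic q (fun x => zchar R q (l * x)).
  move=> x y xy; apply: (zchar_periodic _ q0).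
  by rewrite -mulrBr dvdz_mull.
have := psum_shift 1 P; rewrite (eq_psum _ (g := fun x => zchar R q l *
    zchar R q (l * x))); last first.
  by move=> x; rewrite -zcharD; congr zchar; ring.
rewrite psumM => /eqP; rewrite -subr_eq0 -[X in _ - X]mul1r -mulrBl mulf_eq0.
rewrite subr_eq0 => /orP[/eqP h|/eqP//].
by rewrite (zchar_eq1 q0 h) in ql.
Qed.

(** * Fourier coefficients of the cone *)

Definition lin (a b c x y z : int) : int := a * x + b * y + c * z.

Lemma ler_psum (K : numDomainType) (q : nat) (f g : int -> K) :
  (forall x, f x <= g x) -> psum q f <= psum q g.
Proof. by move=> fg; apply: ler_sum => i _; exact: fg. Qed.

Lemma ler_sum3 (K : numDomainType) (q : nat) (f g : int -> int -> int -> K) :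
  (forall x y z, f x y z <= g x y z) -> sum3 q f <= sum3 q g.
Proof. by move=> fg; do 3![apply: ler_psum => ?]; exact: fg. Qed.

Lemma ler_norm_sum3 (K : numDomainType) (q : nat) (f : int -> int -> int -> K) :
  `|sum3 q f| <= sum3 q (fun x y z => `|f x y z|).
Proof.
rewrite /sum3 /psum.
do 2![apply: (le_trans (ler_norm_sum _ _ _)); apply: ler_sum => ? _].
exact: ler_norm_sum.
Qed.

Lemma sum3M (K : pzSemiRingType) (q : nat) (a : K) (f : int -> int -> int -> K) :
  sum3 q (fun x y z => a * f x y z) = a * sum3 q f.
Proof.
rewrite /sum3 -psumM; apply: eq_psum => x.
by rewrite -psumM; apply: eq_psum => y; rewrite psumM.
Qed.

Definition fcoef (R : realType) (p n : nat) (a b c : int) : R[i] :=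
  sum3 (p ^ n) (fun x y z =>
    (cone p n x y z)%:R * zchar R (p ^ n) (lin a b c x y z)).

Lemma coneM (p n : nat) (t x y z : int) : prime p -> ~~ (p%:Z %| t)%Z ->
  cone p n (t * x) (t * y) (t * z) = cone p n x y z.
Proof.
move=> pp ut; rewrite /cone !prime_dvdzM // !(negbTE ut) /=.
have -> : qf (t * x) (t * y) (t * z) = t ^+ 2 * qf x y z by rewrite /qf; ring.
rewrite Gauss_dvdzr // coprimezXr //; exact: prime_coprimezX.
Qed.

Lemma cone_char_periodic (R : realType) (p n : nat) (a b c : int) (P : pred int) :
  prime p -> zperiodic (p ^ n.+1) P ->
  periodic3 (p ^ n.+1) (fun x y z =>
    (cone p n.+1 x y z && P (lin a b c x y z))%:R *
    zchar R (p ^ n.+1) (lin a b c x y z)).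
Proof.
move=> pp PP x y z x' y' z' hx hy hz.
have hl : ((p ^ n.+1)%N%:Z %| lin a b c x y z - lin a b c x' y' z')%Z.
  rewrite [X in (_ %| X)%Z](_ : _ = a * (x - x') + b * (y - y') + c * (z - z')).
    by rewrite !rpredD ?dvdz_mull.
  by rewrite /lin; ring.
rewrite (cone_periodic (ltn0Sn n) hx hy hz) (PP _ _ hl).
by rewrite (zchar_periodic R _ hl) // expn_gt0 prime_gt0.
Qed.

(* Averaging over the unit scalars [1 + p s], which preserve the cone. *)
Lemma fcoef_restrict (R : realType) (p n : nat) (a b c : int) : prime p ->
  fcoef R p n.+1 a b c = sum3 (p ^ n.+1) (fun x y z =>
    (cone p n.+1 x y z && ((p ^ n)%N%:Z %| lin a b c x y z)%Z)%:R *
    zchar R (p ^ n.+1) (lin a b c x y z)).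
Proof.
move=> pp; set q := (p ^ n.+1)%N.
have q0 : (0 < q)%N by rewrite expn_gt0 prime_gt0.
have p0 : p%:Z != 0 by rewrite eqz_nat -lt0n prime_gt0.
have qq : (q%:R : R[i]) != 0 by rewrite pnatr_eq0 -lt0n.
apply: (mulfI qq).
pose f := fun x y z : int => (cone p n.+1 x y z)%:R * zchar R q (lin a b c x y z).
have fP : periodic3 q f.
  move=> x y z x' y' z' hx hy hz; rewrite /f.
  have := @cone_char_periodic R p n a b c xpredT pp (fun _ _ _ => erefl)
    _ _ _ _ _ _ hx hy hz.
  by rewrite !andbT.
transitivity (\sum_(s < q) sum3 q (fun x y z =>
    f ((1 + p%:Z * s%:Z) * x + 0) ((1 + p%:Z * s%:Z) * y + 0)
      ((1 + p%:Z * s%:Z) * z + 0))).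
  rewrite (eq_bigr (fun=> fcoef R p n.+1 a b c)).
    by rewrite sumr_const card_ord mulr_natl.
  move=> s _; rewrite sum3_affine //; apply: prime_coprimezX => //.
  apply/negP => h; have : (p%:Z %| 1%R)%Z.
    have -> : 1 = (1 + p%:Z * s%:Z) - s%:Z * p%:Z by ring.
    by rewrite rpredB // dvdz_mull.
  by rewrite dvdzE /= dvdn1; apply/negP/eqP => p1; rewrite p1 in pp.
rewrite -sum3_sum -sum3M; apply: eq_sum3 => x y z.
(* The sum over the scalars is a complete character sum with frequency [p * lin a b c x y z]. It
   equals [q] when [p ^ n] divides the linear form and vanishes otherwise. *)
transitivity ((cone p n.+1 x y z)%:R * zchar R q (lin a b c x y z) *
    psum q (fun s => zchar R q (p%:Z * lin a b c x y z * s))).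
  rewrite /psum mulr_sumr; apply: eq_bigr => s _; rewrite /f !addr0 coneM //.
    by rewrite -mulrA -zcharD; congr (_ * zchar _ _ _); rewrite /lin; ring.
  apply/negP => h; have : (p%:Z %| 1%R)%Z.
    have -> : 1 = (1 + p%:Z * s%:Z) - s%:Z * p%:Z by ring.
    by rewrite rpredB // dvdz_mull.
  by rewrite dvdzE /= dvdn1; apply/negP/eqP => p1; rewrite p1 in pp.
have qE : q%:Z = p%:Z * (p ^ n)%N%:Z by rewrite /q expnS PoszM.
rewrite psum_zchar // qE dvdz_mul2l //.
case: (cone p n.+1 x y z); case: ifP => _ /=;
by rewrite ?mul1r ?mul0r ?mulr0 // mulrC.
Qed.

Lemma exact_valuation (p n : nat) (D : int) : ~~ ((p ^ n)%N%:Z %| D)%Z ->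
  exists2 k : nat, (k < n)%N &
    ((p ^ k)%N%:Z %| D)%Z && ~~ ((p ^ k.+1)%N%:Z %| D)%Z.
Proof.
elim: n => [|n IHn]; first by rewrite expn0 dvd1z.
move=> h; have [h'|/IHn[k kn hk]] := boolP ((p ^ n)%N%:Z %| D)%Z.
  by exists n; rewrite ?h' ?h.
by exists k => //; exact: ltnW.
Qed.

(* With [k] the valuation of [qf a b c], translation by
   [p ^ (n - k) * (a, b, - c)] preserves the restricted sum and multiplies the
   character by a nontrivial root of unity. *)
Lemma fcoef_eq0 (R : realType) (p n : nat) (a b c : int) : prime p ->
  ~~ ((p ^ n)%N%:Z %| qf a b c)%Z -> fcoef R p n.+1 a b c = 0.
Proof.
move=> pp /exact_valuation[k kn /andP[/dvdz_exists[d dE] nk]].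
rewrite fcoef_restrict //; set q := (p ^ n.+1)%N.
have q0 : (0 < q)%N by rewrite expn_gt0 prime_gt0.
have nq : ((p ^ n)%N%:Z %| q%:Z)%Z by rewrite dvdzE dvdn_exp2l.
set g := (X in sum3 q X).
have gP : periodic3 q g.
  apply: (@cone_char_periodic R p n a b c (fun l => ((p ^ n)%N%:Z %| l)%Z)) => //.
  by move=> l l' ll'; rewrite (dvdz_congr (dvdz_trans nq ll')).
pose M : int := (p ^ (n - k))%N%:Z.
have Mk : M * (p ^ k)%N%:Z = (p ^ n)%N%:Z.
  by rewrite /M -PoszM -expnD subnK // ltnW.
have pM : (p%:Z %| M)%Z by rewrite /M dvdzE dvdn_exp // subn_gt0.
have [M' ME] := dvdz_exists pM.
have qE : q%:Z = p%:Z * (p ^ n)%N%:Z by rewrite /q expnS PoszM.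
have gS x y z : g (x + M * a) (y + M * b) (z + M * - c) =
    zchar R q (M * qf a b c) * g x y z.
  rewrite /g.
  have -> : lin a b c (x + M * a) (y + M * b) (z + M * - c) =
      M * qf a b c + lin a b c x y z by rewrite /lin /qf; ring.
  rewrite zcharD mulrCA; congr (_ * (_ * _)); congr (_%:R); congr nat_of_bool.
  rewrite (@dvdz_congr _ (_ + lin a b c x y z) (lin a b c x y z)); last first.
    by rewrite addrK dE mulrCA Mk dvdz_mull.
  case: (boolP ((p ^ n)%N%:Z %| lin a b c x y z)%Z); rewrite ?andbF //.
  move=> /dvdz_exists[l lE]; rewrite !andbT /cone.
  have sh u v : (p%:Z %| u + M * v)%Z = (p%:Z %| u)%Z.
    by apply: dvdz_congr; rewrite addrAC subrr add0r dvdz_mulr.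
  rewrite !sh; congr [&& _, _, _ & _]; apply: dvdz_congr.
  (* The translation changes [qf] by [2 * M * lin a b c x y z + M * M * qf a b c]. Both
     [lin a b c x y z] and [M * qf a b c] are multiples of [p ^ n], and the remaining factor [M]
     supplies one more [p] because [k < n]. *)
  rewrite [X in (_ %| X)%Z](_ : _ = (2 * M' * l + M' * d) * q%:Z); last first.
    transitivity (2 * M * lin a b c x y z + M * M * qf a b c).
      by rewrite /qf /lin; ring.
    rewrite lE dE.
    transitivity (2 * M * l * (p ^ n)%N%:Z + M * d * (M * (p ^ k)%N%:Z)).
      by ring.
    by rewrite Mk qE ME; ring.
  exact: dvdz_mull.
have := sum3_shift (M * a) (M * b) (M * - c) gP.
rewrite (eq_sum3 _ gS) sum3M => /eqP.
rewrite -subr_eq0 -[X in _ - X]mul1r -mulrBl mulf_eq0 subr_eq0.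
case/orP => /eqP // /(zchar_eq1 q0) h; case/negP: nk; move: h.
rewrite /q -(subnK (ltnW kn)) -addSn addnC -addSnnS expnD PoszM /M [_ * qf _ _ _]mulrC.
by rewrite dvdz_mul2r // eqz_nat -lt0n expn_gt0 prime_gt0.
Qed.

(** Two solutions satisfy [(z - z0) * (z + z0) = 0] modulo [p ^ n]. Since [p] does not divide
    [2 * z0], it cannot divide both factors, so one factor is a unit and [z] is congruent to [z0] or
    [- z0]. *)
Lemma psum_cone_le2 (K : numDomainType) (p n : nat) (x y : int) :
  prime p -> (2 < p)%N ->
  psum (p ^ n) (fun z => (cone p n x y z)%:R) <= 2 :> K.
Proof.
move=> pp p2; have u2 := odd_prime_ndvdz2 pp p2.
have q0 : (0 < p ^ n)%N by rewrite expn_gt0 prime_gt0.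
have [[z0 /and4P[_ _ uz0 Q0]]|h] :=
    pselect (exists z, cone p n x y z); last first.
  rewrite /psum big1 ?ler0n // => z _.
  by case: (boolP (cone p n x y z)) => // ?; case: h; exists z.
have q1 : coprimez (p ^ n)%N 1 by rewrite /coprimez gcdz1.
have -> : 2 = psum (p ^ n) (fun z => ((p ^ n)%N%:Z %| 1 * z + - z0)%Z%:R) +
    psum (p ^ n) (fun z => ((p ^ n)%N%:Z %| 1 * z + z0)%Z%:R) :> K.
  by rewrite !psum_dvd_affine.
rewrite /psum -big_split; apply: ler_sum => i _ /=; rewrite !mul1r.
case: (boolP (cone p n x y i)) => [/and4P[_ _ uz Q]|_]; last by rewrite addr_ge0.
have D : ((p ^ n)%N%:Z %| (i%:Z + - z0) * (i%:Z + z0))%Z.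
  have -> : (i%:Z + - z0) * (i%:Z + z0) = qf x y z0 - qf x y i%:Z.
    by rewrite /qf; ring.
  by rewrite rpredB.
case: (boolP (p%:Z %| i%:Z + z0)%Z) => h; last first.
  rewrite Gauss_dvdzl in D; last exact: prime_coprimezX.
  by rewrite D lerDl.
have h' : ~~ (p%:Z %| i%:Z + - z0)%Z.
  apply: contra u2 => h'; have : (p%:Z %| 2 * z0)%Z.
    have -> : 2 * z0 = (i%:Z + z0) - (i%:Z + - z0) by ring.
    by rewrite rpredB.
  by rewrite prime_dvdzM // (negbTE uz0) orbF.
rewrite Gauss_dvdzr in D; last exact: prime_coprimezX.
by rewrite D lerDr.
Qed.

Lemma dvdz_sqr (p l : nat) (w : int) :
  ((p ^ (2 * l))%N%:Z %| w ^+ 2)%Z -> ((p ^ l)%N%:Z %| w)%Z.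
Proof. by rewrite !dvdzE abszX /= mulnC expnM dvdn_pexp2r. Qed.

(* On the plane [lin a b c x y z = 0] with [c ^ 2 = a ^ 2 + b ^ 2] one has
   [c ^ 2 * qf x y z = (b * x - a * y) ^ 2]. *)
Lemma count_cone_plane (K : numDomainType) (p n j : nat) (a b c : int) :
  prime p -> (2 < p)%N -> (j <= n)%N ->
  ~~ (p%:Z %| a)%Z || ~~ (p%:Z %| b)%Z -> qf a b c = 0 ->
  sum3 (p ^ n.+1) (fun x y z => (cone p n.+1 x y z &&
    ((p ^ n)%N%:Z %| (p ^ j)%N%:Z * lin a b c x y z)%Z)%:R) <=
  (2 * p ^ (n.+1 + (n.+1 - (n - j)./2)))%N%:R :> K.
Proof.
move=> pp p2 jn uab Q0; set q := (p ^ n.+1)%N; set l := (n - j)./2.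
have ln : (l <= n.+1)%N by rewrite /l; lia.
have pj : (p ^ j)%N%:Z != 0 by rewrite eqz_nat -lt0n expn_gt0 prime_gt0.
have l2 : (2 * l <= n - j)%N by rewrite /l; lia.
(* Dividing by [p ^ j] leaves [lin a b c x y z = 0] modulo [p ^ (n - j)] only, so the square of
   [b * x - a * y] vanishes to that order and the number itself to half of it, rounded down. *)
pose W (x y : int) := ((p ^ l)%N%:Z %| b * x - a * y)%Z.
apply: (@le_trans _ _ (psum q (fun x => psum q (fun y => 2 * (W x y)%:R)))).
  apply: ler_psum => x; apply: ler_psum => y; case: (boolP (W x y)) => [_|nW].
    rewrite mulr1; apply: le_trans (psum_cone_le2 K n.+1 x y pp p2).
    apply: ler_psum => z; case: (cone p n.+1 x y z) => //=.
    by rewrite ler_nat leq_b1.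
  rewrite mulr0 /psum big1 // => z _.
  case: (boolP (_ && _)) => // /andP[/and4P[_ _ _ Q] L].
  case/negP: nW; apply: dvdz_sqr.
  apply: (@dvdz_trans (p ^ (n - j))%N%:Z); first by rewrite dvdzE dvdn_exp2l.
  have {}L : ((p ^ (n - j))%N%:Z %| lin a b c x y z)%Z.
    by rewrite -(dvdz_mul2l pj) -PoszM -expnD subnKC.
  have {}Q : ((p ^ (n - j))%N%:Z %| qf x y z%:Z)%Z.
    apply: dvdz_trans Q; rewrite dvdzE dvdn_exp2l //; lia.
  have -> : (b * x - a * y) ^+ 2 = c ^+ 2 * qf x y z%:Z -
      lin a b c x y z ^+ 2 + 2 * c * z%:Z * lin a b c x y z +
      (x ^+ 2 + y ^+ 2) * qf a b c by rewrite /qf /lin; ring.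
  by rewrite Q0 mulr0 addr0 expr2 rpredD ?rpredB // ?dvdz_mull.
have qE : q = (p ^ (n.+1 - l) * p ^ l)%N by rewrite -expnD subnK.
have l0 : (0 < p ^ l)%N by rewrite expn_gt0 prime_gt0.
have cnt (u v : int) : ~~ (p%:Z %| u)%Z ->
    psum q (fun y => 2 * ((p ^ l)%N%:Z %| u * y + v)%Z%:R) =
    (2 * p ^ (n.+1 - l))%N%:R :> K.
  move=> uu; rewrite psumM qE psum_mul_periodic.
    by rewrite psum_dvd_affine ?natrM //; exact: prime_coprimezX.
  move=> y y' yy'; rewrite (@dvdz_congr _ (u * y + v) (u * y' + v)) //.
  have -> : u * y + v - (u * y' + v) = u * (y - y') by ring.
  by rewrite dvdz_mull.
(* The linear congruence is solved for [y] if [a] is a unit and for [x] if [b] is; the other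
   variable stays free. *)
rewrite expnD mulnCA; case/orP: uab => uu; last rewrite exchange_psum.
  rewrite (eq_psum _ (g := fun=> (2 * p ^ (n.+1 - l))%N%:R)).
    by rewrite psum_cst -[_ *+ q]mulr_natl -natrM.
  move=> x; rewrite -(cnt (- a) (b * x)) ?rpredN //.
  by apply: eq_psum => y; rewrite /W mulNr addrC.
rewrite (eq_psum _ (g := fun=> (2 * p ^ (n.+1 - l))%N%:R)).
  by rewrite psum_cst -[_ *+ q]mulr_natl -natrM.
by move=> y; rewrite -(cnt b (- (a * y))).
Qed.

(** * Integral points on the dual cone *)

Lemma sum3_prod (K : comPzSemiRingType) (q : nat) (f g h : int -> K) :
  sum3 q (fun x y z => f x * g y * h z) = psum q f * psum q g * psum q h.
Proof.
rewrite /sum3 /psum -mulrA mulr_suml; apply: eq_bigr => x _.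
rewrite mulr_suml mulr_sumr; apply: eq_bigr => y _.
by rewrite mulrA mulr_sumr.
Qed.

Lemma psum_eq_le1 (K : numDomainType) (q : nat) (c v : int) : (0 < q)%N ->
  psum q (fun x => (x - c == v)%:R) <= 1 :> K.
Proof.
move=> q0; have q1 : coprimez q 1 by rewrite /coprimez gcdz1.
apply: (@le_trans _ _ (psum q (fun x => (q%:Z %| 1 * x + - (c + v))%Z%:R))).
  apply: ler_psum => x; case: eqP => [<-|_]; last by rewrite ler0n.
  have -> : 1 * x + - (c + (x - c)) = 0 by ring.
  by rewrite dvdz0.
by rewrite psum_dvd_affine.
Qed.

(** From [(z - y) * (z + y) = x ^ 2], put [d = gcd (z + y) x], [z + y = b * d] and [x = a * d]. Then
    [(z - y) * b = d * a ^ 2] with [a], [b] coprime, so [d = g * b]. Neither primitivity nor parity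
    of the triple enters, at the price of stating the formulas for [2 * y] and [2 * z]. *)
Lemma pythagorean_param (x y z : nat) : (x ^ 2 + y ^ 2 = z ^ 2)%N ->
  (0 < z)%N -> exists g a b : nat,
  [/\ (0 < g)%N, (0 < b)%N, (a <= b)%N & [/\ x = (g * a * b)%N,
     (2 * y = g * (b * b - a * a))%N, (2 * z = g * (b * b + a * a))%N &
     (z + y = g * (b * b))%N]].
Proof.
move=> E z0; have yz : (y <= z)%N by rewrite -(leq_exp2r _ _ (isT : (0 < 2)%N)); lia.
set u := (z - y)%N; set v := (z + y)%N.
have v0 : (0 < v)%N by rewrite /v; lia.
have uv : (u * v = x * x)%N.
  by rewrite /u /v -subn_sqr -E; lia.
set d := gcdn v x; have d0 : (0 < d)%N by rewrite /d gcdn_gt0 v0.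
have /dvdnP[b vE] : (d %| v)%N by exact: dvdn_gcdl.
have /dvdnP[a xE] : (d %| x)%N by exact: dvdn_gcdr.
have b0 : (0 < b)%N by move: v0; rewrite vE muln_gt0 => /andP[].
have ab : coprime b a.
  have : (gcdn (b * d) (a * d) = 1 * d)%N by rewrite -vE -xE mul1n.
  by rewrite -muln_gcdl => /eqP; rewrite eqn_pmul2r.
have ub : (u * b = d * (a * a))%N.
  apply/eqP; rewrite -(eqn_pmul2r d0) -mulnA -vE uv xE; apply/eqP; ring.
have /dvdnP[g dE] : (b %| d)%N.
  have : (b %| d * (a * a))%N by rewrite -ub dvdn_mull.
  by rewrite Gauss_dvdl // coprimeMr ab.
have g0 : (0 < g)%N by move: d0; rewrite dE muln_gt0 => /andP[].
have vE' : v = (g * (b * b))%N by rewrite vE dE; ring.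
have uE' : u = (g * (a * a))%N.
  by apply/eqP; rewrite -(eqn_pmul2r b0) ub dE; apply/eqP; ring.
have uv' : (u <= v)%N by rewrite /u /v; lia.
have ab' : (a <= b)%N.
  move: uv'; rewrite vE' uE' leq_pmul2l // => h.
  by rewrite -(leq_exp2r _ _ (isT : (0 < 2)%N)) !expnS !expn0 !muln1.
exists g, a, b; split => //; split=> //.
- by rewrite xE dE; ring.
- by rewrite mulnBr -vE' -uE' /u /v; lia.
- by rewrite mulnDr -vE' -uE' /u /v; lia.
Qed.

(* A harmonic sum, cut into the blocks [p ^ i <= b < p ^ i.+1]. *)
Lemma sum_divn_le (p Y T : nat) : (0 < p)%N ->
  (\sum_(1 <= b < p ^ T) Y %/ b <= T * (p * Y))%N.
Proof.
move=> p0; elim: T => [|T IHT]; first by rewrite expn0 big_geq.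
rewrite (@big_cat_nat _ _ _ (p ^ T)) /= ?expn_gt0 ?p0 ?leq_pexp2l //.
rewrite mulSn addnC leq_add //.
apply: (@leq_trans (\sum_(p ^ T <= b < p ^ T.+1) Y %/ p ^ T)).
  rewrite big_nat_cond [leqRHS]big_nat_cond; apply: leq_sum => b.
  by rewrite andbT => /andP[hb _]; rewrite leq_div2l // expn_gt0 p0.
rewrite sum_nat_const_nat; apply: (@leq_trans (p ^ T.+1 * (Y %/ p ^ T))).
  by rewrite leq_mul2r leq_subr orbT.
by rewrite expnS -mulnA leq_mul2l mulnC leq_trunc_div orbT.
Qed.

(** Here [g * (b * b)] is the sum [z + y] of the parametrised triple. It is below [2 * t] for
    entries below [t], and this single inequality bounds all three parameters. *)
Definition cone_param (Y : nat) (b g a : nat) : bool :=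
  [&& (0 < g)%N, (0 < b)%N, (a <= b)%N & (g * (b * b) < Y)%N].

(** For fixed [b] there are at most [b + 1 <= 2 * b] values of [a] and [Y / b ^ 2] values of [g],
    hence at most [2 * (Y / b)] pairs. The harmonic sum over [b] costs only the factor [t + 1]. *)
Lemma count_cone_param (p t : nat) : (2 < p)%N ->
  (\sum_(b < 2 * p ^ t) \sum_(g < 2 * p ^ t) \sum_(a < 2 * p ^ t)
    cone_param (2 * p ^ t) b g a <= 4 * t.+1 * p ^ t.+1)%N.
Proof.
move=> p2; set Y := (2 * p ^ t)%N.
have Yp : (Y <= p ^ t.+1)%N by rewrite expnS leq_mul2r (ltnW p2) orbT.
have Ha (b g : nat) : (\sum_(a < Y) cone_param Y b g a <=
    ((0 < b) && (0 < g) && (g * (b * b) < Y)) * b.+1)%N.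
  set c := _ && _.
  rewrite (eq_bigr (fun a : 'I_Y => (c && (a < b.+1)) : nat)%N); last first.
    move=> a _; rewrite /cone_param /c ltnS; case: (0 < g)%N; case: (0 < b)%N;
    by rewrite ?andbF //= andbC.
  case: c; last by rewrite big1.
  rewrite mul1n /=.
  rewrite -(big_mkord xpredT (fun a => (a < b.+1 : nat)%N)).
  (* The range is padded beyond both [Y] and [b + 1], so it can be cut at [b + 1] without comparing
     the two. *)
  apply: (@leq_trans (\sum_(0 <= a < Y + b.+1) (a < b.+1)%N)).
    by rewrite (@big_cat_nat _ _ _ Y 0 (Y + b.+1)) ?leq_addr //= leq_addr.
  rewrite (@big_cat_nat _ _ _ b.+1) ?leq_addl //=.
  rewrite [X in (_ + X <= _)%N]big_nat_cond [X in (_ + X <= _)%N]big1.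
    rewrite addn0 -[leqRHS]subn0 -[leqRHS]muln1 -sum_nat_const_nat.
    by apply: leq_sum => a _; exact: leq_b1.
  by move=> a; rewrite andbT => /andP[ha _]; rewrite ltnNge ha.
have Hg (b : nat) : (0 < b)%N -> (\sum_(g < Y) \sum_(a < Y) cone_param Y b g a <=
    2 * (Y %/ b))%N.
  move=> b0; apply: (@leq_trans (\sum_(g < Y) ((0 < g) && (g <= Y %/ (b * b)))%N * b.+1)).
    apply: leq_sum => g _; apply: leq_trans (Ha b g) _.
    rewrite b0 /= leq_mul2r; apply/orP; right.
    case: (0 < g)%N => //=; case: ltnP => // h.
    by rewrite leq_divRL ?muln_gt0 ?b0 // (ltnW h).
  rewrite -big_distrl /=.
  apply: (@leq_trans ((Y %/ (b * b)) * b.+1)).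
    rewrite leq_mul2r; apply/orP; right.
    rewrite -(big_mkord xpredT (fun g => ((0 < g) && (g <= Y %/ (b * b)))%N : nat)).
    apply: (@leq_trans (\sum_(0 <= g < Y + (Y %/ (b * b)).+1)
        ((0 < g) && (g <= Y %/ (b * b)))%N)).
      by rewrite (@big_cat_nat _ _ _ Y 0 (Y + _)) ?leq_addr //= leq_addr.
    rewrite (@big_cat_nat _ _ _ (Y %/ (b * b)).+1) ?leq_addl //=.
    rewrite [X in (_ + X <= _)%N]big_nat_cond [X in (_ + X <= _)%N]big1.
      rewrite addn0 big_ltn //= add0n.
      rewrite -[leqRHS](subKn (leqnSn _)) subSnn -[leqRHS]muln1.
      rewrite [leqRHS](_ : _ = \sum_(1 <= i < (Y %/ (b * b)).+1) 1)%N.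
        by apply: leq_sum => a _; exact: leq_b1.
      by rewrite sum_nat_const_nat.
    by move=> a; rewrite andbT => /andP[ha _]; rewrite [(a <= _)%N]leqNgt ha andbF.
  apply: (@leq_trans ((Y %/ (b * b)) * (2 * b))); first by rewrite leq_mul2l; lia.
  rewrite mulnCA leq_mul2l /= divnMA.
  exact: leq_trunc_div.
rewrite -(big_mkord xpredT (fun b => \sum_(g < Y) \sum_(a < Y) cone_param Y b g a)%N).
have Y0 : (0 < Y)%N by rewrite /Y muln_gt0 expn_gt0; lia.
rewrite big_ltn // [X in (X + _ <= _)%N]big1 ?add0n; last first.
  by move=> g _; apply: big1 => a _; rewrite /cone_param andbF.
apply: (@leq_trans (\sum_(1 <= b < Y) 2 * (Y %/ b))).
  rewrite big_nat_cond [leqRHS]big_nat_cond; apply: leq_sum => b.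
  by rewrite andbT => /andP[hb _]; exact: Hg.
rewrite -big_distrr /=.
apply: (@leq_trans (2 * (t.+1 * (p * Y)))).
  rewrite leq_mul2l /=; apply: leq_trans (@sum_divn_le p Y t.+1 _); last by lia.
  by rewrite [leqRHS](@big_cat_nat _ _ _ Y) //= leq_addr.
by rewrite /Y expnS; apply: eq_leq; ring.
Qed.

Definition small_cone (t : nat) (a b c : int) : bool :=
  [&& (`|a| < t)%N, (`|b| < t)%N, (`|c| < t)%N, qf a b c == 0 &
    ~~ [&& a == 0, b == 0 & c == 0]].

Lemma small_cone_param (t : nat) (a b c : int) : small_cone t a b c ->
  exists g u v : 'I_(2 * t), cone_param (2 * t) v g u /\
  [/\ `|a|%N = (g * u * v)%N, `|b|%N = (g * (v * v - u * u))./2 &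
      `|c|%N = (g * (v * v + u * u))./2].
Proof.
case/and5P => ha hb hc /eqP Q0 nz.
have E : (`|a| ^ 2 + `|b| ^ 2 = `|c| ^ 2)%N.
  apply/eqP; rewrite -eqz_nat PoszD -!abszX !gez0_abs ?sqr_ge0 //.
  by rewrite -subr_eq0; apply/eqP.
have c0 : (0 < `|c|)%N.
  rewrite absz_gt0; apply: contraNneq nz => c0; move/eqP: E.
  rewrite c0 (_ : `|0| ^ 2 = 0)%N // addn_eq0 !expn_eq0 !absz_eq0 !andbT.
  by [].
have [g [u [v [g0 v0 uv [aE bE cE vE]]]]] := pythagorean_param E c0.
have gv : (g * (v * v) < 2 * t)%N by rewrite -vE; lia.
have vY : (v < 2 * t)%N.
  apply: leq_ltn_trans gv; apply: leq_trans (leq_pmulr v v0) _.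
  by rewrite leq_pmull.
have gY : (g < 2 * t)%N.
  by apply: leq_ltn_trans gv; rewrite leq_pmulr // muln_gt0 v0.
exists (Ordinal gY), (Ordinal (leq_ltn_trans uv vY)), (Ordinal vY) => /=.
split; first by rewrite /cone_param g0 v0 uv gv.
by split => //; [rewrite -bE | rewrite -cE]; rewrite mul2n doubleK.
Qed.

(** Each vector is determined by three signs and a parameter triple, and each prescribed vector is
    hit by at most one triple of representatives; 32 is 8 sign patterns times the 4 of the parameter
    count. The shift [c0] is there because frequencies will be recentred around 0. *)
Lemma count_small_cone (K : numDomainType) (p q j t : nat) (c0 : int) :
  (2 < p)%N -> (0 < q)%N ->
  sum3 q (fun x y z => (`[< exists a b c, small_cone (p ^ t) a b c /\
    [/\ x - c0 = (p ^ j)%N%:Z * a, y - c0 = (p ^ j)%N%:Z * b &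
        z - c0 = (p ^ j)%N%:Z * c] >])%:R) <=
  (32 * t.+1 * p ^ t.+1)%N%:R :> K.
Proof.
move=> p2 q0; set Y := (2 * p ^ t)%N.
pose sg (s : bool) (n : nat) : int := if s then - n%:Z else n%:Z.
pose T := ((bool * bool * bool) * ('I_Y * ('I_Y * 'I_Y)))%type.
pose P (w : T) : bool := cone_param Y w.2.1 w.2.2.1 w.2.2.2.
pose F (w : T) (x y z : int) : K :=
  (x - c0 == (p ^ j)%N%:Z * sg w.1.1.1 (w.2.2.1 * w.2.2.2 * w.2.1)%N)%:R *
  (y - c0 == (p ^ j)%N%:Z *
     sg w.1.1.2 ((w.2.2.1 * (w.2.1 * w.2.1 - w.2.2.2 * w.2.2.2))./2)%N)%:R *
  (z - c0 == (p ^ j)%N%:Z *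
     sg w.1.2 ((w.2.2.1 * (w.2.1 * w.2.1 + w.2.2.2 * w.2.2.2))./2)%N)%:R.
apply: (@le_trans _ _ (sum3 q (fun x y z => \sum_(w : T) (P w)%:R * F w x y z))).
  apply: ler_sum3 => x y z; have F0 w : 0 <= (P w)%:R * F w x y z.
    by rewrite /F !mulr_ge0 ?ler0n.
  case: asboolP => [[a [b [c [sc [xa yb zc]]]]]|_]; last exact: sumr_ge0.
  have [g [u [v [Pw [aE bE cE]]]]] := small_cone_param sc.
  have sgE (m : int) : m = sg (m < 0) `|m|%N.
    by rewrite /sg; case: ltP => [/ltW|] h; [rewrite lez0_abs ?opprK | rewrite gez0_abs].
  pose w : T := ((a < 0, b < 0, c < 0), (v, (g, u))).
  rewrite (bigD1 w) //= /F /P /= -[X in X <= _]addr0 lerD //; last first.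
    by apply: sumr_ge0 => i _; exact: F0.
  by rewrite Pw mul1r xa yb zc -aE -bE -cE -!sgE !eqxx !mulr1.
rewrite sum3_sum.
apply: (@le_trans _ _ (\sum_(w : T) (P w)%:R)).
  apply: ler_sum => w _; rewrite sum3M; rewrite -[leRHS]mulr1 ler_wpM2l ?ler0n //.
  rewrite sum3_prod.
  have P01 v : 0 <= psum q (fun x => (x - c0 == v)%:R) :> K.
    by apply: sumr_ge0 => i _; rewrite ler0n.
  by rewrite !mulr_ile1 ?mulr_ge0 ?P01 ?psum_eq_le1.
rewrite -natr_sum ler_nat.
have -> : (\sum_(w : T) P w = \sum_(e : bool * bool * bool)
    \sum_(b < Y) \sum_(g < Y) \sum_(a < Y) cone_param Y b g a)%N.
  rewrite [RHS](eq_bigr (fun=> \sum_(v : 'I_Y * ('I_Y * 'I_Y))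
      cone_param Y v.1 v.2.1 v.2.2)%N); first by rewrite pair_bigA.
  move=> e _; rewrite -(pair_bigA _ (fun (b : 'I_Y) (v : 'I_Y * 'I_Y) =>
    cone_param Y b v.1 v.2 : nat)).
  apply: eq_bigr => b _.
  by rewrite -(pair_bigA _ (fun g a : 'I_Y => cone_param Y b g a : nat)).
rewrite sum_nat_const !card_prod card_bool.
have := count_cone_param t p2; rewrite -/Y => h.
by rewrite (leq_trans (leq_mul (leqnn 8) h)) // !mulnA.
Qed.

(** If [p] divides [a] and [b], it divides [c] because [c ^ 2 = a ^ 2 + b ^ 2]. Each division by [p]
    shrinks the size bound by [p], and a nonzero vector cannot have all entries below 1, so the
    descent stops with [j < r]. The coefficient bound needs a unit among the first two
    coordinates. *)
Lemma primitive_part (p r : nat) (a b c : int) : prime p ->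
  small_cone (p ^ r) a b c -> exists j : nat, (j < r)%N /\
  exists a' b' c', [/\ small_cone (p ^ (r - j)) a' b' c',
    ~~ (p%:Z %| a')%Z || ~~ (p%:Z %| b')%Z &
    [/\ a = (p ^ j)%N%:Z * a', b = (p ^ j)%N%:Z * b' & c = (p ^ j)%N%:Z * c']].
Proof.
move=> pp; have p0 := prime_gt0 pp; elim: r a b c => [|r IHr] a b c.
  case/and5P; rewrite expn0 !ltnS !leqn0 !absz_eq0.
  by move=> -> -> -> _.
move=> sc; have [h|h] := boolP (~~ (p%:Z %| a)%Z || ~~ (p%:Z %| b)%Z).
  exists 0%N; split => //; exists a, b, c; rewrite subn0 expn0 !mul1r; split => //.
have [pa pb] : (p%:Z %| a)%Z /\ (p%:Z %| b)%Z.
  by move: h; rewrite negb_or !negbK => /andP[].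
case/and5P: sc => ha hb hc /eqP Q nz.
have pc : (p%:Z %| c)%Z.
  have : (p%:Z %| c * c)%Z.
    have -> : c * c = a * a + b * b - qf a b c by rewrite /qf; ring.
    by rewrite Q subr0 rpredD // dvdz_mull.
  by rewrite prime_dvdzM // orbb.
case/dvdz_exists: pa => a1 aE; case/dvdz_exists: pb => b1 bE; case/dvdz_exists: pc => c1 cE.
have p0' : p%:Z != 0 by rewrite eqz_nat -lt0n.
have lt m m1 : m = m1 * p%:Z -> (`|m| < p ^ r.+1)%N -> (`|m1| < p ^ r)%N.
  by move=> ->; rewrite abszM expnS mulnC ltn_pmul2l.
have {IHr} [|j [jr [a' [b' [c' [sc uab [aE' bE' cE']]]]]]] := IHr a1 b1 c1.
  apply/and5P; split; [exact: lt aE _|exact: lt bE _|exact: lt cE _| |].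
    have : qf a b c = p%:Z ^+ 2 * qf a1 b1 c1 by rewrite aE bE cE /qf; ring.
    by rewrite Q => /esym/eqP; rewrite mulf_eq0 expf_eq0 (negbTE p0').
  move: nz; rewrite aE bE cE !mulf_eq0 (negbTE p0') !orbF //.
exists j.+1; split => //; exists a', b', c'; rewrite subSS; split => //.
by rewrite aE bE cE aE' bE' cE' expnSr PoszM; split; ring.
Qed.

Lemma norm_fcoef_le (R : realType) (p n j : nat) (a b c : int) :
  prime p -> (2 < p)%N -> (j <= n)%N ->
  ~~ (p%:Z %| a)%Z || ~~ (p%:Z %| b)%Z -> qf a b c = 0 ->
  `|fcoef R p n.+1 ((p ^ j)%N%:Z * a) ((p ^ j)%N%:Z * b) ((p ^ j)%N%:Z * c)| <=
  (2 * p ^ (n.+1 + (n.+1 - (n - j)./2)))%N%:R.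
Proof.
move=> pp p2 jn uab Q; rewrite fcoef_restrict //.
apply: le_trans (count_cone_plane _ pp p2 jn uab Q).
apply: le_trans (ler_norm_sum3 _ _) _; apply: ler_sum3 => x y z.
rewrite normrM normr_zchar mulr1 normr_nat.
by rewrite (_ : lin _ _ _ x y z = (p ^ j)%N%:Z * lin a b c x y z) // /lin; ring.
Qed.

(** Frequencies are sorted by the power [p ^ j] split off to make them primitive. The classes [A j]
    may overlap, which is harmless in an upper bound of nonnegative terms. *)
Lemma sum_small_fcoef (R : realType) (p n r : nat) (c0 : int) :
  prime p -> (2 < p)%N -> (r <= n)%N ->
  sum3 (p ^ n.+1) (fun x y z => (small_cone (p ^ r) (x - c0) (y - c0) (z - c0))%:R
    * `|fcoef R p n.+1 (x - c0) (y - c0) (z - c0)|) <=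
  (\sum_(j < r) (32 * (r - j).+1 * p ^ (r - j).+1) *
     (2 * p ^ (n.+1 + (n.+1 - (n - j)./2))))%N%:R.
Proof.
move=> pp p2 rn; set q := (p ^ n.+1)%N.
have q0 : (0 < q)%N by rewrite expn_gt0 prime_gt0.
pose B j := (2 * p ^ (n.+1 + (n.+1 - (n - j)./2)))%N.
pose A (j : 'I_r) (x y z : int) : R[i] :=
  (`[< exists a b c, small_cone (p ^ (r - j)) a b c /\
    [/\ x - c0 = (p ^ j)%N%:Z * a, y - c0 = (p ^ j)%N%:Z * b &
        z - c0 = (p ^ j)%N%:Z * c] >])%:R.
apply: (@le_trans _ _ (sum3 q (fun x y z => \sum_(j < r) (B j)%:R * A j x y z))).
  apply: ler_sum3 => x y z; have F0 (j : 'I_r) : 0 <= (B j)%:R * A j x y z.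
    by rewrite mulr_ge0 ?ler0n.
  case: (boolP (small_cone _ _ _ _)) => sc; last by rewrite mul0r sumr_ge0.
  have [j [jr [a [b [c [sc' uab [aE bE cE]]]]]]] := primitive_part pp sc.
  rewrite mul1r (bigD1 (Ordinal jr)) //= -[leLHS]addr0 lerD ?sumr_ge0 //.
  rewrite /A asboolT /=; last by exists a, b, c.
  rewrite mulr1 aE bE cE; case/and5P: sc' => _ _ _ /eqP Q _.
  by apply: norm_fcoef_le => //; apply: leq_trans rn; exact: ltnW.
rewrite sum3_sum natr_sum; apply: ler_sum => j _.
rewrite sum3M natrM mulrC ler_wpM2r ?ler0n //.
exact: count_small_cone.
Qed.

(** * Equidistribution of the cone on a smoothed box *)

Definition gsum (R : realType) (q H : nat) (l : int) : R[i] :=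
  \sum_(h < H) zchar R q (l * h%:Z).

Lemma norm_gsum_le (R : realType) (q H : nat) (l : int) :
  `|gsum R q H l| <= H%:R.
Proof.
apply: le_trans (ler_norm_sum _ _ _) _.
rewrite (eq_bigr (fun=> 1)); last by move=> h _; rewrite normr_zchar.
by rewrite sumr_const card_ord.
Qed.

(** The geometric sum times [1 - zchar R q l] has modulus at most 2. With
    [2 ^ i <= p ^ (n - r) < 2 ^ (i + 1)], the dyadic lower bound for that factor applies at [i]. *)
Lemma norm_gsum_far (R : realType) (p n r H : nat) (l : int) : (1 < p)%N ->
  (r <= n)%N -> (p ^ r <= `|l|)%N -> (2 * `|l| <= p ^ n)%N ->
  `|gsum R (p ^ n) H l| <= (2 * p ^ (n - r))%N%:R.
Proof.
move=> p1 rn h1 h2; set q := (p ^ n)%N; have p0 := ltnW p1.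
have q0 : (0 < q)%N by rewrite expn_gt0 p0.
set X := (p ^ (n - r))%N; have X0 : (0 < X)%N by rewrite expn_gt0 p0.
set i := trunc_log 2 X.
have /andP[i1 i2] := trunc_log_bounds (isT : (1 < 2)%N) X0.
have qi : (q <= 2 ^ i.+1 * `|l|)%N.
  rewrite /q -(subnK rn) expnD leq_mul //; exact: ltnW.
have lb := norm_1Bzchar_ge R q0 h2 qi.
have ub : `|gsum R q H l| * `|1 - zchar R q l| <= 2.
  rewrite [`|1 - _|]distrC mulrC -normrM.
  have -> : (zchar R q l - 1) * gsum R q H l = zchar R q l ^+ H - 1.
    by rewrite subrX1 /gsum; congr (_ * _); apply: eq_bigr => h _; rewrite zcharMn.
  rewrite (le_trans (ler_normB _ _)) // normrX normr_zchar expr1n normr1.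
  by rewrite -mulr2n.
apply: (@le_trans _ _ (2 ^+ i.+1)); last first.
  by rewrite -natrX ler_nat expnS leq_mul2l.
apply: (@le_trans _ _ (`|gsum R q H l| * (2 ^+ i * `|1 - zchar R q l|))).
  by rewrite ler_peMr.
by rewrite mulrCA exprSr ler_wpM2l // exprn_ge0.
Qed.

Definition offs (k H : nat) (h : {ffun 'I_k -> 'I_H}) : nat := \sum_(i < k) h i.

Lemma sum_offs_zchar (R : realType) (q k H : nat) (l : int) :
  \sum_(h : {ffun 'I_k -> 'I_H}) zchar R q (l * (offs h)%:Z) = gsum R q H l ^+ k.
Proof.
rewrite -[k in RHS]card_ord -prodr_const /gsum bigA_distr_bigA /=.
apply: eq_bigr => h _; rewrite /offs.
rewrite (big_morph Posz (id1 := 0) PoszD) // mulr_sumr.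
by rewrite (big_morph (zchar R q) (id1 := 1) (op1 := *%R) (zcharD R q)) ?zchar0.
Qed.

Lemma sum3E (V : nmodType) (q : nat) (f : int -> int -> int -> V) :
  sum3 q f = \sum_(v : 'I_q * 'I_q * 'I_q) f v.1.1%:Z v.1.2%:Z v.2%:Z.
Proof.
rewrite -(pair_bigA _ (fun (w : 'I_q * 'I_q) (z : 'I_q) => f w.1%:Z w.2%:Z z%:Z)).
by rewrite -(pair_bigA _ (fun x y : 'I_q => \sum_(z < q) f x%:Z y%:Z z%:Z)).
Qed.

Lemma exchange_sum3 (V : nmodType) (a b : nat)
    (f : int -> int -> int -> int -> int -> int -> V) :
  sum3 a (fun u v w => sum3 b (f u v w)) =
  sum3 b (fun x y z => sum3 a (fun u v w => f u v w x y z)).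
Proof.
rewrite (eq_sum3 _ (fun u v w => sum3E b (f u v w))) sum3_sum.
by rewrite [RHS]sum3E.
Qed.

Lemma sum3_delta (K : comPzSemiRingType) (q : nat) (a b c : int)
    (f : int -> int -> int -> K) : (0 < q)%N -> periodic3 q f ->
  sum3 q (fun x y z => (q%:Z %| x - a)%Z%:R * (q%:Z %| y - b)%Z%:R *
    (q%:Z %| z - c)%Z%:R * f x y z) = f a b c.
Proof.
move=> q0 fP; transitivity (psum q (fun x => (q%:Z %| x - a)%Z%:R *
    psum q (fun y => (q%:Z %| y - b)%Z%:R * f x y c))).
  apply: eq_psum => x; rewrite -psumM; apply: eq_psum => y.
  rewrite mulrA -[f x y c](psum_delta c (f := f x y) q0); last first.
    by move=> z z' ?; apply: fP; rewrite ?subrr.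
  by rewrite -psumM; apply: eq_psum => z; rewrite mulrA.
transitivity (psum q (fun x => (q%:Z %| x - a)%Z%:R * f x b c)).
  apply: eq_psum => x; congr (_ * _).
  rewrite (psum_delta b (f := fun y => f x y c) q0) //.
  by move=> z z' ?; apply: fP; rewrite ?subrr.
rewrite (psum_delta a (f := fun x => f x b c) q0) //.
by move=> z z' ?; apply: fP; rewrite ?subrr.
Qed.

Lemma cone_fourier (R : realType) (p n : nat) (x y z : int) : prime p ->
  (0 < n)%N ->
  (p ^ n)%N%:R ^+ 3 * (cone p n x y z)%:R =
  sum3 (p ^ n) (fun a b c =>
    fcoef R p n a b c * zchar R (p ^ n) (- lin a b c x y z)).
Proof.
move=> pp n0; set q := (p ^ n)%N.
have q0 : (0 < q)%N by rewrite expn_gt0 prime_gt0.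
have cP : periodic3 q (fun x y z => (cone p n x y z)%:R : R[i]).
  by move=> u v w u' v' w' hu hv hw; rewrite (cone_periodic n0 hu hv hw).
rewrite -(sum3_delta x y z q0 cP) -sum3M.
rewrite [RHS](_ : _ = sum3 q (fun a b c => sum3 q (fun u v w =>
   (cone p n u v w)%:R * (zchar R q ((u - x) * a) * zchar R q ((v - y) * b) *
     zchar R q ((w - z) * c))))).
  rewrite exchange_sum3; apply: eq_sum3 => u v w.
  rewrite sum3M sum3_prod !psum_zchar // !mulrA.
  case: (q%:Z %| u - x)%Z; last by rewrite !(mulr0, mul0r).
  case: (q%:Z %| v - y)%Z; last by rewrite !(mulr0, mul0r).
  case: (q%:Z %| w - z)%Z; last by rewrite !(mulr0, mul0r).
  by rewrite !mulr1; ring.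
apply: eq_sum3 => a b c; rewrite mulrC -sum3M; apply: eq_sum3 => u v w.
rewrite mulrCA -!zcharD; congr (_ * zchar _ _ _); rewrite /lin; ring.
Qed.

(* The indicator of the cone, convolved in each variable with the [k]-fold
   convolution of the interval [0, H); the total weight is [H ^ k] per variable.
   The [k]-fold convolution makes its Fourier transform decay like the [k]-th
   power, so that trivial bounds suffice for the large frequencies. *)
Definition avgcone (p n k H : nat) (x y z : int) : nat :=
  \sum_(h : {ffun 'I_k -> 'I_H} * {ffun 'I_k -> 'I_H} * {ffun 'I_k -> 'I_H})
    cone p n (x + (offs h.1.1)%:Z) (y + (offs h.1.2)%:Z) (z + (offs h.2)%:Z).

Lemma avgcone_fourier (R : realType) (p n k H : nat) (x y z : int) : prime p ->
  (0 < n)%N ->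
  (p ^ n)%N%:R ^+ 3 * (avgcone p n k H x y z)%:R =
  sum3 (p ^ n) (fun a b c =>
    fcoef R p n a b c * zchar R (p ^ n) (- lin a b c x y z) *
    (gsum R (p ^ n) H (- a) ^+ k * gsum R (p ^ n) H (- b) ^+ k *
     gsum R (p ^ n) H (- c) ^+ k)).
Proof.
move=> pp n0; rewrite /avgcone natr_sum mulr_sumr.
rewrite (eq_bigr _ (fun h _ => cone_fourier R _ _ _ pp n0)) -sum3_sum.
apply: eq_sum3 => a b c; rewrite -mulr_sumr -mulrA; congr (_ * _).
rewrite -!sum_offs_zchar.
rewrite -(pair_bigA _ (fun (w : {ffun 'I_k -> 'I_H} * {ffun 'I_k -> 'I_H})
  (h : {ffun 'I_k -> 'I_H}) => zchar R (p ^ n) (- lin a b c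
   (x + (offs w.1)%:Z) (y + (offs w.2)%:Z) (z + (offs h)%:Z)))) /=.
rewrite -(pair_bigA _ (fun h1 h2 : {ffun 'I_k -> 'I_H} =>
  \sum_(h : {ffun 'I_k -> 'I_H}) zchar R (p ^ n) (- lin a b c
   (x + (offs h1)%:Z) (y + (offs h2)%:Z) (z + (offs h)%:Z)))) /=.
rewrite -mulrA mulr_suml mulr_sumr; apply: eq_bigr => h1 _.
rewrite mulr_suml !mulr_sumr; apply: eq_bigr => h2 _.
rewrite !mulr_sumr; apply: eq_bigr => h3 _.
by rewrite -!zcharD; congr zchar; rewrite /lin; ring.
Qed.

Lemma ler_sum3_ord (K : numDomainType) (q : nat) (f g : int -> int -> int -> K) :
  (forall x y z : 'I_q, f x%:Z y%:Z z%:Z <= g x%:Z y%:Z z%:Z) ->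
  sum3 q f <= sum3 q g.
Proof. by move=> fg; do 3![apply: ler_sum => ? _]; exact: fg. Qed.

Lemma fcoef_periodic (R : realType) (p n : nat) : prime p -> (0 < n)%N ->
  periodic3 (p ^ n) (fcoef R p n).
Proof.
move=> pp n0 a b c a' b' c' ha hb hc; apply: eq_sum3 => x y z; congr (_ * _).
apply: zchar_periodic; first by rewrite expn_gt0 prime_gt0.
rewrite [X in (_ %| X)%Z](_ : _ = (a - a') * x + (b - b') * y + (c - c') * z).
  by rewrite !rpredD ?dvdz_mulr.
by rewrite /lin; ring.
Qed.

Lemma sum3D (V : nmodType) (q : nat) (f g : int -> int -> int -> V) :
  sum3 q (fun x y z => f x y z + g x y z) = sum3 q f + sum3 q g.
Proof. by rewrite !sum3E big_split. Qed.

Lemma sum3_cst (V : nmodType) (q : nat) (v : V) :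
  sum3 q (fun _ _ _ => v) = v *+ (q ^ 3).
Proof. by rewrite sum3E sumr_const !card_prod !card_ord !expnS expn0 muln1 mulnA. Qed.

Lemma norm_fcoef_triv (R : realType) (p n : nat) (a b c : int) :
  `|fcoef R p n a b c| <= ((p ^ n) ^ 3)%N%:R.
Proof.
apply: le_trans (ler_norm_sum3 _ _) _.
apply: (@le_trans _ _ (sum3 (p ^ n) (fun _ _ _ => 1))).
  apply: ler_sum3 => x y z; rewrite normrM normr_zchar mulr1 normr_nat.
  by rewrite lern1 leq_b1.
by rewrite sum3_cst.
Qed.

Lemma gsum_periodic (R : realType) (q H : nat) : (0 < q)%N ->
  zperiodic q (gsum R q H).
Proof.
move=> q0 x y xy; apply: eq_bigr => h _; apply: zchar_periodic => //.
by rewrite -mulrBl dvdz_mulr.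
Qed.

(** The first error term comes from the small isotropic frequencies, with each averaging factor
    bounded by its total weight [H ^ k]. The second allows for all [q ^ 3] frequencies having some
    coordinate of size at least [p ^ r]: the coefficient is bounded trivially by [q ^ 3], and a
    single averaging factor supplies the decay. *)
Lemma avgcone_bound (R : realType) (p n r k H : nat) (x y z : int) :
  prime p -> (2 < p)%N -> (2 * r < n)%N ->
  `|(p ^ n.+1)%N%:R ^+ 3 * (avgcone p n.+1 k H x y z)%:R -
    ncone R[i] p n.+1 * (H ^ k)%N%:R ^+ 3| <=
  ((H ^ k) ^ 3 * (\sum_(j < r) (32 * (r - j).+1 * p ^ (r - j).+1) *
     (2 * p ^ (n.+1 + (n.+1 - (n - j)./2)))) +
   (p ^ n.+1) ^ 3 * ((p ^ n.+1) ^ 3 *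
     ((H ^ k) ^ 2 * (2 * p ^ (n.+1 - r)) ^ k)))%N%:R.
Proof.
move=> pp p2 rn; rewrite avgcone_fourier //; set q := (p ^ n.+1)%N.
have p0 := prime_gt0 pp.
have q0 : (0 < q)%N by rewrite expn_gt0 p0.
pose g (l : int) := gsum R q H (- l) ^+ k.
have gH l : `|g l| <= (H ^ k)%N%:R.
  by rewrite normrX natrX lerXn2r ?nnegrE ?norm_gsum_le.
pose T a b c := fcoef R p n.+1 a b c * zchar R q (- lin a b c x y z) *
  (g a * g b * g c).
have gP : zperiodic q g.
  move=> u v uv; rewrite /g (@gsum_periodic R q H q0 (- u) (- v)) //.
  by rewrite -opprD rpredN.
have TP : periodic3 q T.
  move=> a b c a' b' c' ha hb hc; rewrite /T.
  rewrite (fcoef_periodic R pp (ltn0Sn n) ha hb hc) (gP _ _ ha) (gP _ _ hb).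
  rewrite (gP _ _ hc) (zchar_periodic R q0 (y := - lin a' b' c' x y z)) //.
  rewrite -opprD rpredN.
  rewrite [X in (_ %| X)%Z](_ : _ = (a - a') * x + (b - b') * y + (c - c') * z).
    by rewrite !rpredD ?dvdz_mulr.
  by rewrite /lin; ring.
(* Shifting by half the modulus replaces the representatives 0, ..., q - 1 by those of absolute
   value at most [q / 2], for which size is meaningful. *)
set c0 : int := q./2%:Z.
have -> : sum3 q (fun a b c => fcoef R p n.+1 a b c *
    zchar R q (- lin a b c x y z) *
    (gsum R q H (- a) ^+ k * gsum R q H (- b) ^+ k * gsum R q H (- c) ^+ k)) =
    sum3 q (fun a b c => T (a - c0) (b - c0) (c - c0)).
  by rewrite (sum3_shift (- c0) (- c0) (- c0) TP).
have T0 : ncone R[i] p n.+1 * (H ^ k)%N%:R ^+ 3 = T 0 0 0.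
  rewrite /T /g /gsum oppr0.
  have -> : \sum_(h < H) zchar R q (0 * h%:Z) = H%:R.
    rewrite (eq_bigr (fun=> 1)) ?sumr_const ?card_ord // => h _.
    by rewrite mul0r zchar0.
  have -> : lin 0 0 0 x y z = 0 by rewrite /lin !mul0r !addr0.
  rewrite oppr0 zchar0 mulr1 natrX; congr (_ * _); last by ring.
  apply: eq_sum3 => u v w.
  have -> : lin 0 0 0 u v w = 0 by rewrite /lin !mul0r !addr0.
  by rewrite zchar0 mulr1.
pose T' a b c := T (a - c0) (b - c0) (c - c0).
have TP' : periodic3 q T'.
  move=> a b c a' b' c' ha hb hc; apply: TP.
  - by have -> : a - c0 - (a' - c0) = a - a' by ring.
  - by have -> : b - c0 - (b' - c0) = b - b' by ring.
  - by have -> : c - c0 - (c' - c0) = c - c' by ring.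
rewrite T0 [T 0 0 0](_ : _ = T' c0 c0 c0); last by rewrite /T' subrr.
rewrite -(sum3_delta c0 c0 c0 q0 TP').
(* The main term, written as a delta sum, is subtracted termwise: the resulting factor kills the
   zero frequency and is 1 elsewhere. *)
have -> : sum3 q (fun a b c => T (a - c0) (b - c0) (c - c0)) -
    sum3 q (fun x0 y0 z0 => (q %| x0 - c0)%Z%:R * (q %| y0 - c0)%Z%:R *
      (q %| z0 - c0)%Z%:R * T' x0 y0 z0) =
   sum3 q (fun a b c => (1 - (q %| a - c0)%Z%:R * (q %| b - c0)%Z%:R *
      (q %| c - c0)%Z%:R) * T (a - c0) (b - c0) (c - c0)).
  rewrite /sum3 /psum -sumrB; apply: eq_bigr => a _.
  rewrite -sumrB; apply: eq_bigr => b _; rewrite -sumrB; apply: eq_bigr => c _.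
  by rewrite /T'; ring.
apply: le_trans (ler_norm_sum3 _ _) _.
apply: (@le_trans _ _ (sum3 q (fun a b c => ((H ^ k) ^ 3)%N%:R *
  ((small_cone (p ^ r) (a - c0) (b - c0) (c - c0))%:R *
   `|fcoef R p n.+1 (a - c0) (b - c0) (c - c0)|) +
   (q ^ 3 * ((H ^ k) ^ 2 * (2 * p ^ (n.+1 - r)) ^ k))%N%:R))); last first.
  rewrite sum3D sum3M sum3_cst natrD natrM lerD //.
    rewrite natrM ler_wpM2l ?ler0n //.
    by apply: sum_small_fcoef => //; lia.
  by rewrite -natrM [leRHS]natrM mulr_natl.
apply: ler_sum3_ord => u v w.
have far (i : 'I_q) : (2 * `|i%:Z - c0| <= q)%N.
  by rewrite /c0; have := ltn_ord i; lia.
have := far u; have := far v; have := far w.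
set a := u%:Z - c0; set b := v%:Z - c0; set c := w%:Z - c0 => hc hb ha.
rewrite normrM.
have d1 : `|1 - (q%:Z %| a)%Z%:R * (q%:Z %| b)%Z%:R * (q%:Z %| c)%Z%:R| <=
    1 :> R[i].
  rewrite -!natrM !mulnb; case: (_ && _) => /=; rewrite ?subrr ?subr0 ?normr0 //.
  by rewrite normr1.
have normT : `|T a b c| = `|fcoef R p n.+1 a b c| * (`|g a| * `|g b| * `|g c|).
  by rewrite /T !normrM normr_zchar mulr1.
have [sm|nsm] := boolP [&& (`|a| < p ^ r)%N, (`|b| < p ^ r)%N & (`|c| < p ^ r)%N].
  rewrite -[leLHS]addr0 lerD ?ler0n //.
  case/and3P: sm => sa sb sc.
  have [/and3P[/eqP a0 /eqP b0 /eqP c00]|nz] :=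
      boolP [&& a == 0, b == 0 & c == 0].
    rewrite a0 b0 c00 dvdz0 !mulr1 subrr normr0 mul0r.
    by rewrite !mulr_ge0 ?ler0n.
  have [Q0|Q0] := eqVneq (qf a b c) 0.
    rewrite /small_cone sa sb sc Q0 eqxx nz /= mul1r normT mulrC.
    apply: (@le_trans _ _ (`|fcoef R p n.+1 a b c| * (`|g a| * `|g b| * `|g c|) * 1)).
      by rewrite ler_wpM2l // !mulr_ge0.
    rewrite mulr1 mulrC ler_wpM2r // natrX !exprS expr0 mulr1 mulrA.
    by rewrite !ler_pM ?mulr_ge0.
  (* A nonzero value of [qf] at such a frequency has absolute value below
     [2 * p ^ (2 * r) <= p ^ n], so it is not divisible by [p ^ n]; this is where [2 * r < n]
     matters. *)
  rewrite normT fcoef_eq0 ?normr0 ?mul0r ?mulr0 //.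
  apply/negP => /dvdz_exists[e eE].
  have : (p ^ n <= `|qf a b c|)%N.
    rewrite eE abszM /= leq_pmull // absz_gt0.
    by apply: contraNneq Q0 => e0; rewrite eE e0 mul0r.
  have prn : (2 * (p ^ r * p ^ r) <= p ^ n)%N.
    rewrite -expnD; apply: (@leq_trans (p ^ (2 * r).+1)).
      rewrite expnS addnn -mul2n leq_mul2r; apply/orP; right; exact: ltnW.
    by rewrite leq_exp2l // ltnW.
  have sq (m : int) : (`|m| < p ^ r)%N -> 0 <= m ^+ 2 < (p ^ r * p ^ r)%N%:Z.
    move=> hm; rewrite sqr_ge0 /=.
    have -> : m ^+ 2 = (`|m| * `|m|)%N%:Z.
      have [h|/ltW h] := lerP 0 m; first by rewrite PoszM gez0_abs.
      by rewrite PoszM lez0_abs // mulrNN.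
    by rewrite ltz_nat ltn_mul.
  move: (sq a sa) (sq b sb) (sq c sc); rewrite /qf.
  move: prn; lia.
rewrite -[leLHS]add0r lerD ?mulr_ge0 ?ler0n //.
apply: (@le_trans _ _ `|T a b c|); first by rewrite ler_piMl.
rewrite normT natrM ler_pM ?mulr_ge0 ?norm_fcoef_triv //.
have gfar (l : int) : (2 * `|l| <= q)%N -> ~~ (`|l| < p ^ r)%N ->
    `|g l| <= ((2 * p ^ (n.+1 - r)) ^ k)%N%:R.
  move=> h1; rewrite -leqNgt => h2.
  rewrite normrX natrX lerXn2r ?nnegrE //.
  by apply: norm_gsum_far; rewrite ?abszN //; lia.
rewrite natrM natrX expr2.
move: nsm; rewrite !negb_and => /or3P[] h.
- rewrite mulrC mulrA mulrAC; apply: ler_pM; rewrite ?mulr_ge0 ?gfar //.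
  by apply: ler_pM; rewrite ?gH.
- rewrite mulrAC; apply: ler_pM; rewrite ?mulr_ge0 ?gfar //.
  by apply: ler_pM; rewrite ?gH.
- apply: ler_pM; rewrite ?mulr_ge0 ?gfar //.
  by apply: ler_pM; rewrite ?gH.
Qed.

Lemma norm_complex_real (R : realType) (x : R) : `|x%:C| = `|x|%:C.
Proof. by rewrite normc_def /= expr0n addr0 sqrtr_sqr. Qed.

Lemma avgcone_boundR (R : realType) (p n r k H : nat) (x y z : int) :
  prime p -> (5 < p)%N -> (2 * r < n)%N ->
  `|(p ^ n.+1)%N%:R ^+ 3 * (avgcone p n.+1 k H x y z)%:R -
    (p%:R - 1) * (p%:R - (s p)%:R) * p%:R ^+ (2 * n) * (H ^ k)%N%:R ^+ 3| <=
  ((H ^ k) ^ 3 * (\sum_(j < r) (32 * (r - j).+1 * p ^ (r - j).+1) *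
     (2 * p ^ (n.+1 + (n.+1 - (n - j)./2)))) +
   (p ^ n.+1) ^ 3 * ((p ^ n.+1) ^ 3 *
     ((H ^ k) ^ 2 * (2 * p ^ (n.+1 - r)) ^ k)))%N%:R :> R.
Proof.
move=> pp p5 rn; have p2 : (2 < p)%N by lia.
have := avgcone_bound R k H x y z pp p2 rn; rewrite ncone_eq //.
set B := (_ + _)%N.
rewrite -lecR -norm_complex_real rmorph_nat rmorphB !rmorphM /= !rmorphXn.
by rewrite !rmorphB /= !rmorph_nat rmorph1.
Qed.

(** The proportion of cone points modulo [q = p ^ n], multiplied by [q]; it does not depend on
    [n >= 1]. *)
Definition density (R : realType) (p : nat) : R :=
  (p%:R - (s p)%:R) * (p%:R - 1) / p%:R ^+ 2.

(** Comparing exponents, the claim is [r + d - j <= (n - j) / 2] up to rounding, and [r + d] is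
    [n / 2]: passing to multiples of [p ^ j] loses [j] in the count and gains only [j / 2] in the
    coefficient. *)
Lemma weight_bound (p n d r j : nat) : (0 < p)%N -> r = (n./2 - d)%N ->
  (d <= n./2)%N -> (j < r)%N ->
  (p ^ (r - j).+1 * p ^ (n.+1 + (n.+1 - (n - j)./2)) * p ^ d <=
   p * (p ^ n.+1) ^ 2)%N.
Proof.
move=> p0 rE dn jr; rewrite -expnM -expnS -!expnD leq_pexp2l //; lia.
Qed.

(* [H] is about [p ^ (n / 2 + 2 * d)], and frequencies below
   [p ^ (n / 2 - d)] are small. The rate [4 / 7] comes from
   [n ^ 2 / p ^ d <= D ^ 2 * 4 ^ d / 7 ^ d]. *)
Lemma avgcone_asymp (R : realType) (p D : nat) : prime p -> (5 < p)%N ->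
  (2 < D)%N -> exists2 C : R, 0 <= C & forall (n d H : nat) (x y z : int), (D <= n)%N ->
  d = (n %/ D)%N -> H = (p ^ (n.+1 - (n./2 - d) + d))%N ->
  `|(p ^ n.+1)%N%:R * (avgcone p n.+1 (5 * D) H x y z)%:R /
      (H ^ (5 * D))%N%:R ^+ 3 - density R p| <= C * (4 / 7) ^+ d.
Proof.
move=> pp p5 D2; set k := (5 * D)%N.
have p0 := prime_gt0 pp; have p7 : (7 <= p)%N.
  by rewrite ltn_neqAle p5 andbT; apply: contraTneq pp => <-.
have p0' : 0 < p%:R :> R by rewrite ltr0n.
pose C : R := (64 * p * D ^ 2)%N%:R + (2 ^ k * p ^ k)%N%:R.
exists C; first by rewrite addr_ge0.
move=> n d H x y z Dn dE HE; set r := (n./2 - d)%N in HE *.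
have d1 : (0 < d)%N by rewrite dE divn_gt0 //; lia.
have dn2 : (d <= n./2)%N.
  have : (d * D <= n)%N by rewrite dE; exact: leq_trunc_div.
  have : (d * 3 <= d * D)%N by rewrite leq_mul2l D2 orbT.
  lia.
have rn : (2 * r < n)%N by rewrite /r; lia.
have nD : (n.+1 <= D * d.+1)%N.
  have := ltn_ceil n (ltnW (ltnW D2)); rewrite -dE mulnC; lia.
have hb := @avgcone_boundR R p n r k H x y z pp p5 rn.
set q := (p ^ n.+1)%N in hb *.
have q0 : (0 < q)%N by rewrite expn_gt0 p0.
have H0 : (0 < H)%N by rewrite HE expn_gt0 p0.
have W0 : (0 < H ^ k)%N by rewrite expn_gt0 H0.
set A := avgcone _ _ _ _ _ _ _ in hb *.
set S1 := (\sum_(j < r) _)%N in hb.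
have S1b : (S1 * p ^ d <= 64 * p * n.+1 ^ 2 * q ^ 2)%N.
  rewrite /S1 big_distrl /=.
  apply: (@leq_trans (\sum_(j < r) 64 * n.+1 * (p * q ^ 2))%N).
    apply: leq_sum => j _.
    have := weight_bound p0 (erefl r) dn2 (ltn_ord j); rewrite -/q => h.
    apply: (@leq_trans (64 * (r - j).+1 * (p ^ (r - j).+1 *
       p ^ (n.+1 + (n.+1 - (n - j)./2)) * p ^ d))%N).
      by apply: eq_leq; ring.
    rewrite leq_mul // leq_mul2l /=; lia.
  rewrite sum_nat_const card_ord.
  apply: (@leq_trans (n.+1 * (64 * n.+1 * (p * q ^ 2)))); last first.
    by apply: eq_leq; ring.
  by rewrite leq_mul2r; apply/orP; right; lia.
(* Since [H = p ^ (n + 1 - r) * p ^ d], a large frequency saves [p ^ d] over the trivial bound [H]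
   for each of the [k] intervals, up to a factor 2. *)
have S2b : ((2 * p ^ (n.+1 - r)) ^ k * p ^ (d * k) = 2 ^ k * H ^ k)%N.
  by rewrite HE expnMn -mulnA expnM -expnMn -expnD.
(* The choice [k = 5 * D] is made for this: [n + 1 <= D * (d + 1)] turns [k] savings of [p ^ d] into
   [q ^ 5], up to the constant [p ^ k]. *)
have pk : (q ^ 5 <= p ^ k * p ^ (d * k))%N.
  rewrite /q -expnM -expnD leq_pexp2l // /k.
  have -> : (5 * D + d * (5 * D) = D * d.+1 * 5)%N by ring.
  by rewrite leq_mul2r nD orbT.
have Wr : 0 < (H ^ k)%N%:R :> R by rewrite ltr0n.
have qr : 0 < q%:R :> R by rewrite ltr0n.
have E : q%:R * A%:R / (H ^ k)%N%:R ^+ 3 - density R p =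
  (q%:R ^+ 3 * A%:R - (p%:R - 1) * (p%:R - (s p)%:R) * p%:R ^+ (2 * n) *
     (H ^ k)%N%:R ^+ 3) / (q%:R ^+ 2 * (H ^ k)%N%:R ^+ 3).
  have qE : q%:R ^+ 2 = p%:R ^+ (2 * n) * p%:R ^+ 2 :> R.
    by rewrite /q natrX -exprM -exprD mulnC mulnS addnC.
  rewrite mulrBl; congr (_ - _).
    by field; rewrite !lt0r_neq0.
  rewrite qE /density; field.
  by rewrite !lt0r_neq0 // exprn_gt0.
rewrite E normrM normfV (ger0_norm (x := q%:R ^+ 2 * _)); last first.
  by rewrite mulr_ge0 // exprn_ge0 // ltW.
rewrite ler_pdivrMr; last by rewrite mulr_gt0 // exprn_gt0.
apply: le_trans hb _; rewrite natrD /C.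
have pd0 : 0 < p%:R ^+ d :> R by rewrite exprn_gt0.
have f47 : (p%:R ^+ d)^-1 <= (4 / 7) ^+ d * (4 ^+ d)^-1 :> R.
  rewrite exprMn -mulrA mulrCA mulfV ?mulr1 ?expf_neq0 //.
  rewrite exprVn lef_pV2 ?posrE ?exprn_gt0 //.
  by rewrite lerXn2r ?nnegrE // ler_nat.
have d2 : (d.+1 <= 2 ^ d)%N by exact: ltn_expl.
rewrite mulrDl mulrDl; apply: lerD.
- rewrite natrM natrX mulrC [leRHS]mulrA ler_wpM2r ?exprn_ge0 //.
  rewrite -[leLHS](mulfK (lt0r_neq0 pd0)) ler_pdivrMr //.
  have : (S1 * p ^ d)%N%:R <= (64 * p * (D ^ 2 * 4 ^ d) * q ^ 2)%N%:R :> R.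
    rewrite ler_nat (leq_trans S1b) // leq_mul // leq_mul //.
    apply: (@leq_trans ((D * d.+1) ^ 2)); first by rewrite leq_exp2r.
    by rewrite expnMn leq_mul // -[4%N]/(2 ^ 2)%N -expnM mulnC expnM leq_exp2r.
  rewrite natrM natrX => h; apply: le_trans h _.
  have h4 : 4 ^+ d <= (4 / 7) ^+ d * p%:R ^+ d :> R.
    move: f47; rewrite ler_pdivlMr ?exprn_gt0 // mulrC ler_pdivrMr //.
  have -> : (64 * p * (D ^ 2 * 4 ^ d) * q ^ 2)%N%:R =
      (64 * p * D ^ 2)%N%:R * q%:R ^+ 2 * 4 ^+ d :> R.
    by rewrite -!natrX -!natrM; congr (_%:R); ring.
  set c1 := (64 * p * D ^ 2)%N%:R.
  rewrite [leRHS](_ : _ = (c1 * q%:R ^+ 2) * ((4 / 7) ^+ d * p%:R ^+ d)).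
    by rewrite ler_wpM2l // mulr_ge0 // ?ler0n // exprn_ge0.
  by move: ((4 / 7) ^+ d) (p%:R ^+ d) (q%:R ^+ 2) => u v w; ring.
- have pdk0 : 0 < p%:R ^+ (d * k) :> R by rewrite exprn_gt0.
  rewrite -[leLHS](mulfK (lt0r_neq0 pdk0)) ler_pdivrMr //.
  have -> : (q ^ 3 * (q ^ 3 * ((H ^ k) ^ 2 * (2 * p ^ (n.+1 - r)) ^ k)))%N%:R *
      p%:R ^+ (d * k) = (2 ^ k * q ^ 6 * (H ^ k) ^ 3)%N%:R :> R.
    rewrite -natrX -natrM; congr (_%:R).
    transitivity (q ^ 6 * (H ^ k) ^ 2 *
      ((2 * p ^ (n.+1 - r)) ^ k * p ^ (d * k)))%N; first by ring.
    by rewrite S2b; ring.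
  (* Four of the five powers of [q] bring the trivial bound [q ^ 6] down to the main size [q ^ 2];
     the fifth is spent here on the rate. *)
  have h1 : 1 <= (4 / 7) ^+ d * q%:R :> R.
    have : (p%:R ^+ d)^-1 <= (4 / 7) ^+ d :> R.
      apply: le_trans f47 _; rewrite ler_piMr ?exprn_ge0 ?divr_ge0 //.
      by rewrite invf_le1 ?exprn_gt0 // exprn_ege1 // ler1n.
    rewrite -[leLHS]mul1r ler_pdivrMr // => h; apply: le_trans h _.
    rewrite ler_wpM2l ?exprn_ge0 ?divr_ge0 // -natrX ler_nat leq_pexp2l //.
    by move: dn2; clear; lia.
  have h2 : q%:R ^+ 5 <= p%:R ^+ k * p%:R ^+ (d * k) :> R.
    by rewrite -!natrX -natrM ler_nat.
  have -> : (2 ^ k * q ^ 6 * (H ^ k) ^ 3)%N%:R =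
      ((2 ^ k)%N%:R * (H ^ k)%N%:R ^+ 3 * q%:R) * (1 * q%:R ^+ 5) :> R.
    by rewrite mul1r -!natrX -!natrM; congr (_%:R); ring.
  rewrite natrM [(p ^ k)%N%:R]natrX.
  move: h1 h2 Wr qr; move: (p%:R ^+ k) (p%:R ^+ (d * k)) ((4 / 7) ^+ d).
  move: (q%:R) ((H ^ k)%N%:R) => Q W u v w h1 h2 W0' Q0'.
  apply: (@le_trans _ _ (((2 ^ k)%N%:R * W ^+ 3 * Q) * ((w * Q) * (u * v)))).
    rewrite ler_wpM2l ?mulr_ge0 ?exprn_ge0 ?ler0n ?(ltW Q0') ?(ltW W0') //.
    by rewrite ler_pM ?exprn_ge0 ?(ltW Q0').
  by rewrite le_eqVlt; apply/orP; left; apply/eqP; ring.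
Qed.

(** * Sums over the integers and integrals *)

Lemma esumZl (R : realType) (T : choiceType) (A : set T) (c : R)
    (f : T -> \bar R) : 0 <= c -> (forall x, 0 <= f x)%E ->
  (\esum_(x in A) (c%:E * f x) = c%:E * \esum_(x in A) f x)%E.
Proof.
move=> c0 f0; rewrite /esum -ereal_supZl //; last first.
  by apply/set0P; eexists; exists set0; [exact: fsets_set0|].
congr ereal_sup; rewrite image_comp; apply/seteqP.
split=> _ [X XA <-]; exists X => //=; first by rewrite ge0_mule_fsumr.
by rewrite ge0_mule_fsumr.
Qed.

Lemma esum_setX (R : realType) (T1 T2 : choiceType) (f : T1 -> T2 -> \bar R) :
  (forall x y, 0 <= f x y)%E ->
  (\esum_(v in [set: T1 * T2]) f v.1 v.2 =
   \esum_(x in [set: T1]) \esum_(y in [set: T2]) f x y)%E.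
Proof.
move=> f0; rewrite esum_esum //; congr esum.
by apply/seteqP; split.
Qed.

Lemma esum_prod3 (R : realType) (g : int -> R) (z : R) :
  (forall a, 0 <= g a) -> (\esum_(a in [set: int]) (g a)%:E = z%:E)%E ->
  (\esum_(v in [set: int * int * int])
     (g v.1.1 * g v.1.2 * g v.2)%:E = (z ^+ 3)%:E)%E.
Proof.
move=> g0 gz; have z0 : 0 <= z.
  by rewrite -lee_fin -gz esum_ge0 // => a _; rewrite lee_fin.
rewrite (@esum_setX _ _ _ (fun w c => (g w.1 * g w.2 * g c)%:E)); last first.
  by move=> *; rewrite lee_fin !mulr_ge0.
rewrite (eq_esum (b := fun w => z%:E * (g w.1 * g w.2)%:E)%E); last first.
  by move=> w _; rewrite muleC -gz -esumZl ?mulr_ge0.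
rewrite esumZl //; last by move=> w; rewrite lee_fin mulr_ge0.
rewrite (@esum_setX _ _ _ (fun a b => (g a * g b)%:E)); last first.
  by move=> *; rewrite lee_fin !mulr_ge0.
rewrite (eq_esum (b := fun a => z%:E * (g a)%:E)%E); last first.
  by move=> w _; rewrite muleC -gz -esumZl.
by rewrite esumZl // gz -!EFinM; congr (_%:E); ring.
Qed.

Definition int_enum (n : nat) : int := if odd n then Negz n./2 else Posz n./2.

Lemma int_enum_bij : set_bij [set: nat] [set: int] int_enum.
Proof.
split => //.
- move=> m n _ _; rewrite /int_enum.
  case om : (odd m); case on : (odd n) => // -[mn].
  + by rewrite -(odd_double_half m) -(odd_double_half n) om on mn.
  + by rewrite -(odd_double_half m) -(odd_double_half n) om on mn.
- move=> [k|k] _; first by exists k.*2 => //; rewrite /int_enum odd_double doubleK.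
  exists k.*2.+1 => //.
  by rewrite /int_enum /= odd_double /= uphalf_double.
Qed.

Definition cell (R : realType) (N : R) (a : int) : set R :=
  `[a%:~R / N, (a + 1)%:~R / N[%classic.

Lemma cellP (R : realType) (N : R) (a : int) (x : R) : 0 < N ->
  cell N a x <-> Num.floor (x * N) = a.
Proof.
move=> N0; rewrite /cell /= in_itv /= ler_pdivrMr // ltr_pdivlMr //.
split=> [h|<-]; last by rewrite floor_le floorD1_gt.
by apply/eqP; rewrite floor_eq.
Qed.

Lemma integral_cells (R : realType) (N : R) (f : R -> R) : 0 < N ->
  (forall x, 0 <= f x) -> measurable_fun setT f ->
  (\int[lebesgue_measure]_x (f x)%:E =
   \esum_(a in [set: int]) \int[lebesgue_measure]_(x in cell N a) (f x)%:E)%E.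
Proof.
move=> N0 f0 mf; rewrite (reindex_esum _ _ _ _ int_enum_bij) -nneseries_esumT; last first.
  by move=> n; apply: integral_ge0 => x _; rewrite lee_fin.
have U : [set: R] = \bigcup_k cell N (int_enum k).
  apply/seteqP; split => // x _.
  have [_ _ sj] := int_enum_bij.
  have [k _ kE] := sj (Num.floor (x * N)) I.
  by exists k => //; rewrite cellP.
rewrite U ge0_integral_bigcup //.
- by move=> k; exact: measurable_itv.
- by rewrite -U; apply/measurable_EFinP.
- by move=> x _; rewrite lee_fin.
- move=> i j _ _ [x [/(cellP _ _ N0) xi /(cellP _ _ N0) xj]].
  have [_ ij _] := int_enum_bij.
  by apply: ij; rewrite ?inE // -xi -xj.
Qed.

Lemma measure_cell (R : realType) (N : R) (a : int) : 0 < N ->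
  lebesgue_measure (cell N a) = (N^-1)%:E.
Proof.
move=> N0; rewrite /cell lebesgue_measure_itv /= lte_fin ltr_pM2r ?invr_gt0 //.
rewrite ltr_int ltrDl ltr01 -EFinD -mulrBl -rmorphB /=.
by rewrite addrAC subrr add0r mul1r.
Qed.

Lemma cell_shift (R : realType) (N : R) (a : int) (x : R) : 0 < N ->
  cell N a x -> exists2 u, 0 <= u <= N^-1 & x = a%:~R / N + u.
Proof.
move=> N0; rewrite /cell /= in_itv /= rmorphD mulrDl mul1r => /andP[h1 h2].
exists (x - a%:~R / N); last by ring.
by rewrite subr_ge0 h1 lerBlDl ltW.
Qed.

(** Each cell has length [1 / N], so [g a] is [N] times the integral of the constant [g a] over the
    cell of [a], where [f] dominates it. *)
Lemma esum_le_integral (R : realType) (N : R) (f : R -> R) (g : int -> R) :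
  0 < N -> (forall x, 0 <= f x) -> measurable_fun setT f ->
  (forall a, 0 <= g a) ->
  (forall a u, 0 <= u <= N^-1 -> g a <= f (a%:~R / N + u)) ->
  (\esum_(a in [set: int]) (g a)%:E <=
   N%:E * \int[lebesgue_measure]_x (f x)%:E)%E.
Proof.
move=> N0 f0 mf g0 gf; rewrite (integral_cells N0 f0 mf) -esumZl ?(ltW N0) //; last first.
  by move=> a; apply: integral_ge0 => x _; rewrite lee_fin.
apply: le_esum => a _.
have -> : (g a)%:E = (N%:E * \int[lebesgue_measure]_(x in cell N a) (cst (g a)%:E x))%E.
  rewrite integral_cst; last exact: measurable_itv.
  rewrite [X in (_ * (_ * X))%E](_ : _ = (N^-1)%:E); last exact: measure_cell.
  rewrite -!EFinM; congr (_%:E); field; exact: lt0r_neq0.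
apply: lee_pmul => //; rewrite ?lee_fin ?(ltW N0) //.
  by apply: integral_ge0 => x _; rewrite lee_fin.
apply: ge0_le_integral => //.
- exact: measurable_itv.
- by move=> x _; rewrite lee_fin.
- by apply/measurable_EFinP; apply: measurable_funS mf.
- by move=> x /(cell_shift N0)[u hu ->]; rewrite lee_fin gf.
Qed.

Lemma integral_le_esum (R : realType) (N : R) (f : R -> R) (g : int -> R) :
  0 < N -> (forall x, 0 <= f x) -> measurable_fun setT f ->
  (forall a, 0 <= g a) ->
  (forall a u, 0 <= u <= N^-1 -> f (a%:~R / N + u) <= g a) ->
  (N%:E * \int[lebesgue_measure]_x (f x)%:E <=
   \esum_(a in [set: int]) (g a)%:E)%E.
Proof.
move=> N0 f0 mf g0 gf; rewrite (integral_cells N0 f0 mf) -esumZl ?(ltW N0) //; last first.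
  by move=> a; apply: integral_ge0 => x _; rewrite lee_fin.
apply: le_esum => a _.
have -> : (g a)%:E = (N%:E * \int[lebesgue_measure]_(x in cell N a) (cst (g a)%:E x))%E.
  rewrite integral_cst; last exact: measurable_itv.
  rewrite [X in (_ * (_ * X))%E](_ : _ = (N^-1)%:E); last exact: measure_cell.
  rewrite -!EFinM; congr (_%:E); field; exact: lt0r_neq0.
apply: lee_pmul => //; rewrite ?lee_fin ?(ltW N0) //.
  by apply: integral_ge0 => x _; rewrite lee_fin.
apply: ge0_le_integral => //.
- exact: measurable_itv.
- by move=> x _; rewrite lee_fin.
- by apply/measurable_EFinP; apply: measurable_funS mf.
- by move=> x /(cell_shift N0)[u hu ->]; rewrite lee_fin gf.
Qed.

(** * Decay and Lipschitz bounds for Schwartz functions *)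

Lemma integral_oneDsqrV (R : realType) :
  (\int[lebesgue_measure]_x ((oneDsqr x)^-1)%:E = (pi : R)%:E)%E.
Proof.
rewrite (@ge0_symfun_integralT _ (fun x : R => (oneDsqr x)^-1)).
- have -> : [set x : R | 0 <= x] = `[0, +oo[%classic.
    by apply/seteqP; split => x /=; rewrite in_itv /= andbT.
  by rewrite integral0y_oneDsqr -EFinM; congr (_%:E); field.
- by move=> x; rewrite invr_ge0 (le_trans ler01) // oneDsqr_ge1.
- exact: continuous_oneDsqrV.
- by move=> x; rewrite /oneDsqr /= sqrrN.
Qed.

Lemma schwartz_bound (R : realType) (Phi : R -> R) (k : nat) : schwartz Phi ->
  exists2 C : R, 0 < C &
    forall x, `|(Phi^`(k))%classic x| <= C * (oneDsqr x)^-1.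
Proof.
case=> _ /[dup] /(_ 0%N k)[C0 h0] /(_ 2%N k)[C2 h2].
have C00 : 0 <= C0 by apply: le_trans (h0 0); rewrite mulr_ge0.
have C20 : 0 <= C2 by apply: le_trans (h2 0); rewrite mulr_ge0.
exists (C0 + C2 + 1); first by rewrite ltr_wpDl // addr_ge0.
move=> x; have o0 : 0 < oneDsqr x by rewrite (lt_le_trans ltr01) // oneDsqr_ge1.
rewrite ler_pdivlMr // /oneDsqr mulrDr mulr1 ler_wpDr //.
apply: lerD; first by have := h0 x; rewrite expr0 mul1r.
by rewrite -[x ^+ 2]real_normK ?num_real // mulrC.
Qed.

(** Over a unit step the weight varies by a bounded factor only. This moves a bound from an
    intermediate point back to the base point, and compares sums of the weight with its integral. *)
Lemma oneDsqrV_slow (R : realType) (y u : R) : 0 <= u <= 1 ->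
  (oneDsqr (y + u))^-1 <= 3 * (oneDsqr y)^-1 /\
  (oneDsqr y)^-1 <= 3 * (oneDsqr (y + u))^-1.
Proof.
move=> /andP[u0 u1].
have o0 (x : R) : 0 < oneDsqr x by rewrite (lt_le_trans ltr01) // oneDsqr_ge1.
have uu : u ^+ 2 <= 1 by rewrite expr_le1.
split; rewrite ler_pdivlMr // mulrC ler_pdivrMr // /oneDsqr.
  have : 0 <= (y + 2 * u) ^+ 2 by exact: sqr_ge0.
  nra.
have : 0 <= (y - u) ^+ 2 by exact: sqr_ge0.
nra.
Qed.

(** The mean value theorem, with the decay of the derivative at the intermediate point carried back
    to [y]. The decaying weight is essential: summed over all integers, the errors then total only
    O(N) times the step. *)
Lemma schwartz_lip (R : realType) (Phi : R -> R) : schwartz Phi ->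
  exists2 C : R, 0 < C & forall y u, 0 <= u <= 1 ->
    `|Phi (y + u) - Phi y| <= C * u * (oneDsqr y)^-1.
Proof.
move=> hs; have [C C0 hC] := schwartz_bound 1 hs.
have dPhi x : derivable Phi x 1 by exact: hs.1 0%N x.
exists (3 * C); first by rewrite mulr_gt0.
move=> y u /andP[u0 u1].
have [|||c] := @MVT_segment R Phi (Phi^`())%classic y (y + u).
- by rewrite lerDl.
- by move=> x _; rewrite derive1E; exact/derivableP.
- apply: continuous_subspaceT => x.
  by apply/differentiable_continuous/derivable1_diffP.
rewrite in_itv /= => /andP[yc cu] ->.
rewrite addrAC subrr add0r normrM (ger0_norm u0) mulrAC ler_wpM2r //.
apply: le_trans (hC c) _; rewrite -mulrA mulrCA ler_wpM2l ?(ltW C0) //.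
have hc : 0 <= c - y <= 1.
  by rewrite subr_ge0 yc lerBlDl (le_trans cu) // lerD2l.
by have [h _] := oneDsqrV_slow y hc; move: h; rewrite addrC subrK.
Qed.

(** * The weighted count *)

Lemma natzX (p n : nat) : (p ^ n)%N%:Z = p%:Z ^+ n.
Proof. by elim: n => [|n IHn]; rewrite ?expnS ?PoszM ?IHn ?exprS. Qed.

(** Extended real values allow shifting and rearranging freely; finiteness is derived later from the
    upper bound itself. *)
Definition csum (R : realType) (p n : nat) (F : int -> R) : \bar R :=
  \esum_(v in [set: int * int * int])
    ((cone p n v.1.1 v.1.2 v.2)%:R * (F v.1.1 * F v.1.2 * F v.2))%:E.

Lemma smooth_countE (R : realType) (Phi : R -> R) (p n : nat) (N : R) :
  prime p ->
  smooth_count Phi p n N = fine (csum p n (fun a => Phi (a%:~R / N))).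
Proof.
move=> pp; rewrite /smooth_count /csum esum_mkcond; congr fine.
apply: eq_esum => -[[x1 x2] x3] _ /=.
suff -> : ((x1, x2, x3) \in pythagorean_mod p n) = cone p n x1 x2 x3.
  by case: (cone _ _ _ _ _); rewrite ?mul1r ?mul0r.
have E : (gcdz (x1 * x2 * x3) p%:Z == 1) =
    [&& ~~ (p%:Z %| x1)%Z, ~~ (p%:Z %| x2)%Z & ~~ (p%:Z %| x3)%Z].
  transitivity (coprimez p (x1 * x2 * x3)); first by rewrite coprimez_sym.
  by rewrite prime_coprimez // !prime_dvdzM // !negb_or andbA.
have Q : ((x1 ^+ 2 + x2 ^+ 2 - x3 ^+ 2 == 0 %[mod p%:Z ^+ n])%Z) =
    ((p ^ n)%N%:Z %| qf x1 x2 x3)%Z.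
  by rewrite eqz_mod_dvd subr0 natzX.
have -> : cone p n x1 x2 x3 = (gcdz (x1 * x2 * x3) p%:Z == 1) &&
    ((x1 ^+ 2 + x2 ^+ 2 - x3 ^+ 2 == 0 %[mod p%:Z ^+ n])%Z).
  by rewrite E Q /cone -!andbA.
apply/idP/idP; rewrite inE /pythagorean_mod /=.
  by case=> /eqP -> /eqP ->.
by case/andP => /eqP -> /eqP ->.
Qed.

Lemma shift_bij (a b c : int) : set_bij [set: int * int * int]
  [set: int * int * int] (fun v => (v.1.1 + a, v.1.2 + b, v.2 + c)).
Proof.
split => //.
  by move=> [[x y] z] [[x' y'] z'] _ _ [/addIr -> /addIr -> /addIr ->].
move=> [[x y] z] _; exists (x - a, y - b, z - c) => //=.
by rewrite !subrK.
Qed.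

Lemma csum_shift (R : realType) (p n : nat) (F : int -> R) (a b c : int) :
  csum p n F = (\esum_(v in [set: int * int * int])
    ((cone p n (v.1.1 + a) (v.1.2 + b) (v.2 + c))%:R *
     (F (v.1.1 + a) * F (v.1.2 + b) * F (v.2 + c)))%:E)%E.
Proof. by rewrite /csum (reindex_esum _ _ _ _ (shift_bij a b c)). Qed.

(** Every translation permutes the integer triples, so each of the [(H ^ k) ^ 3] translated sums has
    the same value. *)
Lemma csum_average (R : realType) (p n k H : nat) (F : int -> R) :
  (((H ^ k) ^ 3)%N%:R%:E * csum p n F =
  \sum_(h : {ffun 'I_k -> 'I_H} * {ffun 'I_k -> 'I_H} * {ffun 'I_k -> 'I_H})
   \esum_(v in [set: int * int * int])
    ((cone p n (v.1.1 + (offs h.1.1)%:Z) (v.1.2 + (offs h.1.2)%:Z)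
        (v.2 + (offs h.2)%:Z))%:R *
     (F (v.1.1 + (offs h.1.1)%:Z) * F (v.1.2 + (offs h.1.2)%:Z) *
      F (v.2 + (offs h.2)%:Z)))%:E)%E.
Proof.
rewrite (eq_bigr (fun=> 1%:E * csum p n F))%E; last first.
  by move=> h _; rewrite mul1e -csum_shift.
rewrite -ge0_sume_distrl; last by move=> h _; rewrite lee_fin.
rewrite sumEFin sumr_const !card_prod !card_ffun !card_ord.
by rewrite !expnS expn0 muln1 mulnA.
Qed.

(** Once the translated weights are replaced by [G], which does not depend on the translation, the
    sum over translations acts on the cone indicator alone and produces [avgcone]. The uniform bound
    [M] comes out, and the sum over triples factors into a cube. *)
Lemma csum_le (R : realType) (p n k H : nat) (F G : int -> R) (M z : R) :
  (forall a, 0 <= F a) -> (forall a, 0 <= G a) -> 0 <= M ->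
  (forall a (h : {ffun 'I_k -> 'I_H}), F (a + (offs h)%:Z) <= G a) ->
  (forall x y w, (avgcone p n k H x y w)%:R <= M) ->
  (\esum_(a in [set: int]) (G a)%:E = z%:E)%E ->
  (((H ^ k) ^ 3)%N%:R%:E * csum p n F <= (M * z ^+ 3)%:E)%E.
Proof.
move=> F0 G0 M0 FG AM Gz; rewrite csum_average EFinM -(esum_prod3 G0 Gz).
rewrite -esumZl //; last by move=> v; rewrite lee_fin !mulr_ge0.
rewrite -esum_sum; last by move=> v h _ _; rewrite lee_fin !mulr_ge0.
apply: le_esum => v _; rewrite sumEFin -EFinM lee_fin.
apply: (@le_trans _ _ ((avgcone p n k H v.1.1 v.1.2 v.2)%:R *
    (G v.1.1 * G v.1.2 * G v.2))); last by rewrite ler_wpM2r ?AM ?mulr_ge0.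
rewrite /avgcone natr_sum mulr_suml; apply: ler_sum => h _.
by rewrite ler_wpM2l // !ler_pM ?mulr_ge0.
Qed.

Lemma csum_ge (R : realType) (p n k H : nat) (F G : int -> R) (M z : R) :
  (forall a, 0 <= F a) -> (forall a, 0 <= G a) -> 0 <= M ->
  (forall a (h : {ffun 'I_k -> 'I_H}), G a <= F (a + (offs h)%:Z)) ->
  (forall x y w, M <= (avgcone p n k H x y w)%:R) ->
  (\esum_(a in [set: int]) (G a)%:E = z%:E)%E ->
  ((M * z ^+ 3)%:E <= ((H ^ k) ^ 3)%N%:R%:E * csum p n F)%E.
Proof.
move=> F0 G0 M0 FG AM Gz; rewrite csum_average EFinM -(esum_prod3 G0 Gz).
rewrite -esumZl //; last by move=> v; rewrite lee_fin !mulr_ge0.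
rewrite -esum_sum; last by move=> v h _ _; rewrite lee_fin !mulr_ge0.
apply: le_esum => v _; rewrite sumEFin -EFinM lee_fin.
apply: (@le_trans _ _ ((avgcone p n k H v.1.1 v.1.2 v.2)%:R *
    (G v.1.1 * G v.1.2 * G v.2))); first by rewrite ler_wpM2r ?AM ?mulr_ge0.
rewrite /avgcone natr_sum mulr_suml; apply: ler_sum => h _.
by rewrite ler_wpM2l // !ler_pM ?mulr_ge0.
Qed.

Lemma offs_le (k H : nat) (h : {ffun 'I_k -> 'I_H}) : (offs h <= k * H)%N.
Proof.
apply: (@leq_trans (\sum_(i < k) H)); last by rewrite sum_nat_const card_ord.
by apply: leq_sum => i _; exact: ltnW.
Qed.

Lemma schwartz_continuous (R : realType) (Phi : R -> R) : schwartz Phi ->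
  continuous Phi.
Proof.
move=> hs x; apply/differentiable_continuous/derivable1_diffP.
exact: hs.1 0%N x.
Qed.

(** Finiteness is domination by a multiple of the weight; positivity holds because [Phi] stays above
    half of [Phi x0] on a short interval to the right of [x0]. *)
Lemma schwartz_integral (R : realType) (Phi : R -> R) :
  (forall x, 0 <= Phi x) -> schwartz Phi -> (exists x, Phi x != 0) ->
  exists2 J : R, 0 < J & (\int[lebesgue_measure]_x (Phi x)%:E = J%:E)%E.
Proof.
move=> P0 hs [x0 x00].
have mP : measurable_fun setT Phi.
  by apply: continuous_measurable_fun; exact: schwartz_continuous.
have [C C0 hC] := schwartz_bound 0 hs.
have o1 (x : R) : 0 < (oneDsqr x)^-1.
  by rewrite invr_gt0 (lt_le_trans ltr01) // oneDsqr_ge1.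
have mO : measurable_fun setT (fun x : R => (oneDsqr x)^-1).
  by apply: continuous_measurable_fun; exact: continuous_oneDsqrV.
have fin : (\int[lebesgue_measure]_x (Phi x)%:E \is a fin_num)%E.
  rewrite ge0_fin_numE; last by apply: integral_ge0 => x _; rewrite lee_fin.
  apply: (@le_lt_trans _ _ (\int[lebesgue_measure]_x
      (C%:E * ((oneDsqr x)^-1)%:E))%E).
    apply: ge0_le_integral => //.
    - by move=> x _; rewrite lee_fin.
    - exact/measurable_EFinP.
    - apply/measurable_EFinP; exact: measurable_funM.
    - by move=> x _; rewrite -EFinM lee_fin -[leLHS]ger0_norm.
  rewrite ge0_integralZl_EFin //.
  - by rewrite integral_oneDsqrV -EFinM ltry.
  - exact/measurable_EFinP.
  - exact: ltW.
exists (fine (\int[lebesgue_measure]_x (Phi x)%:E)); last by rewrite fineK.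
have [L L0 hL] := schwartz_lip hs.
have Px : 0 < Phi x0 by rewrite lt_neqAle eq_sym x00 P0.
(* The bound 1 keeps the Lipschitz estimate applicable, and the other limits the drop of [Phi] to
   [Phi x0 / 2]. *)
pose u := Num.min 1 (Phi x0 / (2 * L)).
have u0 : 0 < u by rewrite lt_min ltr01 divr_gt0 // mulr_gt0.
have low x : x0 <= x <= x0 + u -> Phi x0 / 2 <= Phi x.
  move=> /andP[h1 h2]; have hx : 0 <= x - x0 <= 1.
    rewrite subr_ge0 h1 lerBlDl (le_trans h2) // lerD2l.
    by rewrite /u ge_min lexx.
  have xE : x0 + (x - x0) = x by ring.
  have := hL x0 (x - x0) hx; rewrite xE => h.
  have hu : L * (x - x0) * (oneDsqr x0)^-1 <= Phi x0 / 2.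
    apply: (@le_trans _ _ (L * (x - x0))).
      rewrite ler_piMr ?mulr_ge0 ?(ltW L0) //; first by case/andP: hx.
      exact: oneDsqrV_le1.
    apply: (@le_trans _ _ (L * u)); first by rewrite ler_wpM2l ?(ltW L0) // lerBlDl.
    apply: (@le_trans _ _ (L * (Phi x0 / (2 * L)))).
      by rewrite ler_wpM2l ?(ltW L0) // /u ge_min lexx orbT.
    rewrite le_eqVlt; apply/orP; left; apply/eqP; field; exact: lt0r_neq0.
  have {h hu} := le_trans h hu; rewrite ler_norml => /andP[h _].
  by lra.
rewrite -lte_fin fineK //; apply: (@lt_le_trans _ _ (Phi x0 / 2 * u)%:E).
  by rewrite lte_fin mulr_gt0 // divr_gt0.
pose A : set R := `[x0, x0 + u]%classic.
have mA : measurable A by exact: measurable_itv.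
have muA : lebesgue_measure A = u%:E.
  rewrite /A lebesgue_measure_itv /= lte_fin ltrDl u0 -EFinD.
  by congr (_%:E); ring.
have h1 : ((Phi x0 / 2 * u)%:E <=
    \int[lebesgue_measure]_(x in A) (cst (Phi x0 / 2)%:E x))%E.
  rewrite integral_cst //.
  by rewrite [X in (_ <= _ * X)%E](_ : _ = u%:E) ?EFinM.
have h2 : (\int[lebesgue_measure]_(x in A) (cst (Phi x0 / 2)%:E x) <=
    \int[lebesgue_measure]_(x in A) (Phi x)%:E)%E.
  apply: ge0_le_integral => //.
  - by move=> x _; rewrite lee_fin divr_ge0.
  - by apply/measurable_EFinP; apply: measurable_funS mP.
have h3 : (\int[lebesgue_measure]_(x in A) (Phi x)%:E <=
    \int[lebesgue_measure]_x (Phi x)%:E)%E.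
  apply: ge0_subset_integral => //; first exact/measurable_EFinP.
  by move=> x _; rewrite lee_fin.
exact: le_trans h1 (le_trans h2 h3).
Qed.

Lemma fourier0 (R : realType) (Phi : R -> R) (J : R) :
  (\int[lebesgue_measure]_x (Phi x)%:E = J%:E)%E -> fourier Phi 0 = J%:C.
Proof.
move=> hJ; rewrite /fourier /complex_integral.
have E x : (Phi x)%:C * expi (- (2 * pi * x * 0)) = (Phi x)%:C.
  by rewrite mulr0 oppr0 /expi cos0 sin0 complexr0 mulr1.
have ER : (fun x => complex.Re ((Phi x)%:C * expi (- (2 * pi * x * 0)))) = Phi.
  by apply/funext => x; rewrite E.
have EI : (fun x => complex.Im ((Phi x)%:C * expi (- (2 * pi * x * 0)))) = cst 0.
  by apply/funext => x; rewrite E.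
rewrite ER EI /Rintegral hJ integral0 /=; exact: complexr0.
Qed.

(** Two independent errors are kept apart: [e] measures the equidistribution of the averaged cone,
    and [eta] the largest translate relative to [N]. The side conditions keep both lower factors
    nonnegative, so that products and cubes preserve inequalities. *)
Lemma count_estimate (R : realType) (Phi : R -> R) (p D : nat) (J : R) :
  prime p -> (5 < p)%N -> (2 < D)%N ->
  (forall x, 0 <= Phi x) -> schwartz Phi ->
  (\int[lebesgue_measure]_x (Phi x)%:E = J%:E)%E ->
  exists2 K : R, 0 < K & forall (n d H : nat) (N : R), (D <= n)%N ->
  d = (n %/ D)%N -> H = (p ^ (n.+1 - (n./2 - d) + d))%N -> 0 < N ->
  let eta := (5 * D * H)%N%:R / N in let e := K * (4 / 7) ^+ d in
  let S := smooth_count Phi p n.+1 N * (p ^ n.+1)%N%:R / N ^+ 3 in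
  eta <= 1 -> e <= density R p -> K * eta <= J ->
  (density R p - e) * (J - K * eta) ^+ 3 <= S <=
  (density R p + e) * (J + K * eta) ^+ 3.
Proof.
move=> pp p5 D2 P0 hs hJ.
have [C1 C10 hC1] := avgcone_asymp R pp p5 D2.
have [L L0 hL] := schwartz_lip hs.
have pi0 := pi_gt0 R.
(* [C1] pays for equidistribution and [6 * pi * L] for smoothing and the Riemann sum; the 1 makes
   [K] positive. *)
pose K : R := C1 + 6 * pi * L + 1.
have KL : 6 * pi * L <= K by rewrite /K; lra.
have Lp : 0 <= 6 * pi * L by rewrite !mulr_ge0 // ltW.
have K0 : 0 < K by rewrite /K; lra.
exists K => // n d H N Dn dE HE N0 eta e S eta1 ed etaJ.
set k := (5 * D)%N in eta eta1 etaJ S *; set q := (p ^ n.+1)%N in S *.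
have p0 := prime_gt0 pp.
have q0 : 0 < q%:R :> R by rewrite ltr0n expn_gt0 p0.
have H0 : (0 < H)%N by rewrite HE expn_gt0 p0.
have kH0 : (0 < k * H)%N.
  by rewrite /k !muln_gt0 H0 andbT /=; apply: leq_trans D2.
have W0 : 0 < ((H ^ k) ^ 3)%N%:R :> R by rewrite ltr0n !expn_gt0 H0.
(* Hence the same envelopes control both translations by [offs h] and variation within a cell of
   length [1 / N]. *)
have N1 : N^-1 <= eta.
  by rewrite /eta -[leLHS]mul1r ler_wpM2r ?invr_ge0 ?(ltW N0) // ler1n.
have eta0 : 0 < eta by apply: lt_le_trans N1; rewrite invr_gt0.
have e0 : 0 <= e by rewrite mulr_ge0 ?(ltW K0) // exprn_ge0 // divr_ge0.
have mP : measurable_fun setT Phi.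
  by apply: continuous_measurable_fun; exact: schwartz_continuous.
have mO : measurable_fun setT (fun x : R => (oneDsqr x)^-1).
  by apply: continuous_measurable_fun; exact: continuous_oneDsqrV.
have o1 (x : R) : 0 < (oneDsqr x)^-1.
  by rewrite invr_gt0 (lt_le_trans ltr01) // oneDsqr_ge1.
pose P a := Phi (a%:~R / N); pose V (a : int) : R := (oneDsqr (a%:~R / N))^-1.
pose lam := L * eta; have lam0 : 0 <= lam by rewrite mulr_ge0 ?(ltW L0) ?(ltW eta0).
(* Upper and lower envelopes of [Phi] over steps of size at most [eta]. Truncation at 0 keeps the
   lower one nonnegative, as cubing requires. *)
pose Gp a := P a + lam * V a; pose Gm a := Num.max 0 (P a - lam * V a).
have Gp0 a : 0 <= Gp a by rewrite addr_ge0 ?P0 // mulr_ge0 // ltW // o1.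
have Gm0 a : 0 <= Gm a by rewrite le_max lexx.
have near a u : 0 <= u <= eta -> Gm a <= Phi (a%:~R / N + u) <= Gp a.
  move=> /andP[u0 u1]; have hu : 0 <= u <= 1 by rewrite u0 (le_trans u1).
  have := hL (a%:~R / N) u hu; rewrite -/(V a) => h.
  have {}h : `|Phi (a%:~R / N + u) - P a| <= lam * V a.
    by apply: le_trans h _; rewrite ler_wpM2r ?(ltW (o1 _)) // ler_wpM2l // ltW.
  move: h; rewrite ler_norml ge_max P0 /= => /andP[h1 h2]; rewrite /Gp.
  by apply/andP; split; lra.
have near1 a u : 0 <= u <= N^-1 -> Gm a <= Phi (a%:~R / N + u) <= Gp a.
  by move=> /andP[u0 u1]; apply: near; rewrite u0 (le_trans u1).
(* By slow variation, a third of [V a] lies below the weight on the whole cell of [a], and the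
   weight has integral [pi]. *)
have sV : (\esum_(a in [set: int]) (V a / 3)%:E <= (N * pi)%:E)%E.
  rewrite EFinM -integral_oneDsqrV; apply: esum_le_integral => //.
  - by move=> a; rewrite divr_ge0 // ltW // o1.
  - move=> a u /andP[u0 u1].
    have hu : 0 <= u <= 1 by rewrite u0 (le_trans u1) // (le_trans N1).
    by rewrite ler_pdivrMr // mulrC; have [_] := oneDsqrV_slow (a%:~R / N) hu.
have sGm : (\esum_(a in [set: int]) (Gm a)%:E <= (N * J)%:E)%E.
  rewrite EFinM -hJ; apply: esum_le_integral => // a u hu.
  by have /andP[] := near1 a u hu.
have sGp : ((N * J)%:E <= \esum_(a in [set: int]) (Gp a)%:E)%E.
  rewrite EFinM -hJ; apply: integral_le_esum => // a u hu.
  by have /andP[] := near1 a u hu.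
have V0 a : (0 <= (V a / 3)%:E)%E by rewrite lee_fin divr_ge0 // ltW // o1.
(* The envelopes differ by at most [2 * lam * V a], that is [6 * lam] times [V a / 3]. As [N * J]
   lies between their sums, both sums are within this total of [N * J]. *)
have GpGm : (\esum_(a in [set: int]) (Gp a)%:E <=
    \esum_(a in [set: int]) (Gm a)%:E + (6 * lam * (N * pi))%:E)%E.
  apply: (@le_trans _ _ (\esum_(a in [set: int]) (Gm a)%:E +
      (6 * lam)%:E * \esum_(a in [set: int]) (V a / 3)%:E)%E).
    rewrite -esumZl //; last by rewrite mulr_ge0.
    have A1 a : [set: int] a -> (0 <= (Gm a)%:E)%E by rewrite lee_fin.
    have A2 a : [set: int] a -> (0 <= (6 * lam)%:E * (V a / 3)%:E)%E.
      by move=> _; rewrite mule_ge0 // lee_fin mulr_ge0.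
    rewrite -(esumD A1 A2); apply: le_esum => a _.
    rewrite -EFinM -EFinD lee_fin.
    have : P a - lam * V a <= Gm a by rewrite le_max lexx orbT.
    have -> : 6 * lam * (V a / 3) = 2 * (lam * V a) by field.
    by rewrite /Gp; lra.
  by rewrite leeD2l // [leRHS]EFinM lee_wpmul2l // lee_fin mulr_ge0.
have fm : (\esum_(a in [set: int]) (Gm a)%:E \is a fin_num)%E.
  rewrite ge0_fin_numE ?(le_lt_trans sGm) ?ltry //.
  by apply: esum_ge0 => a _; rewrite lee_fin.
pose zm := fine (\esum_(a in [set: int]) (Gm a)%:E)%E.
have zmE : (\esum_(a in [set: int]) (Gm a)%:E = zm%:E)%E by rewrite fineK.
have fp : (\esum_(a in [set: int]) (Gp a)%:E \is a fin_num)%E.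
  rewrite ge0_fin_numE ?(le_lt_trans GpGm) // ?zmE -?EFinD ?ltry //.
  by apply: esum_ge0 => a _; rewrite lee_fin.
pose zp := fine (\esum_(a in [set: int]) (Gp a)%:E)%E.
have zpE : (\esum_(a in [set: int]) (Gp a)%:E = zp%:E)%E by rewrite fineK.
rewrite zmE lee_fin in sGm; rewrite zpE lee_fin in sGp.
rewrite zmE zpE -EFinD lee_fin in GpGm.
have zm0 : 0 <= zm.
  by rewrite -lee_fin -zmE; apply: esum_ge0 => a _; rewrite lee_fin.
have lamE : 6 * lam * (N * pi) <= N * (K * eta).
  have -> : 6 * lam * (N * pi) = N * (6 * pi * L * eta) by rewrite /lam; ring.
  by rewrite ler_wpM2l ?(ltW N0) // ler_wpM2r // ltW.
have zmL : N * (J - K * eta) <= zm by rewrite mulrBr; lra.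
have zpU : zp <= N * (J + K * eta) by rewrite mulrDr; lra.
pose w : R := (H ^ k)%N%:R; have w0 : 0 < w by rewrite ltr0n expn_gt0 H0.
have AB x y z : (density R p - e) * w ^+ 3 / q%:R <= (avgcone p n.+1 k H x y z)%:R
     <= (density R p + e) * w ^+ 3 / q%:R.
  have := hC1 n d H x y z Dn dE HE; rewrite -/k -/q -/w.
  have Ce : C1 * (4 / 7) ^+ d <= e.
    rewrite /e ler_wpM2r ?exprn_ge0 ?divr_ge0 // /K.
    by rewrite -addrA lerDl addr_ge0.
  move=> /le_trans /(_ Ce); rewrite ler_norml => /andP[h1 h2].
  have w30 : 0 < w ^+ 3 by rewrite exprn_gt0.
  have AE : (avgcone p n.+1 k H x y z)%:R =
      (q%:R * (avgcone p n.+1 k H x y z)%:R / w ^+ 3) * (w ^+ 3 / q%:R).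
    by field; rewrite !lt0r_neq0.
  have wq : 0 < w ^+ 3 / q%:R by rewrite divr_gt0.
  move: h1 h2 AE; move: (q%:R * _ / w ^+ 3) => X h1 h2 AE.
  by apply/andP; split; rewrite AE -mulrA ler_pM2r //; lra.
have dens0 : 0 <= density R p by exact: le_trans ed.
have offsN a (h : {ffun 'I_k -> 'I_H}) :
    Gm a <= P (a + (offs h)%:Z) <= Gp a.
  have -> : P (a + (offs h)%:Z) = Phi (a%:~R / N + (offs h)%:R / N).
    by rewrite /P rmorphD /= mulrDl.
  apply: near; rewrite divr_ge0 ?ler0n ?(ltW N0) //=.
  by rewrite ler_wpM2r ?invr_ge0 ?(ltW N0) // ler_nat offs_le.
have up := @csum_le R p n.+1 k H P Gp ((density R p + e) * w ^+ 3 / q%:R) zp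
  (fun a => P0 _) Gp0.
have {}up : ((((H ^ k) ^ 3)%N%:R)%:E * csum p n.+1 P <=
    ((density R p + e) * w ^+ 3 / q%:R * zp ^+ 3)%:E)%E.
  apply: up => //.
  - by rewrite divr_ge0 ?(ltW q0) // mulr_ge0 ?addr_ge0 // exprn_ge0 // ltW.
  - by move=> a h; have /andP[] := offsN a h.
  - by move=> x y z; have /andP[] := AB x y z.
have lo := @csum_ge R p n.+1 k H P Gm ((density R p - e) * w ^+ 3 / q%:R) zm
  (fun a => P0 _) Gm0.
have {}lo : (((density R p - e) * w ^+ 3 / q%:R * zm ^+ 3)%:E <=
    (((H ^ k) ^ 3)%N%:R)%:E * csum p n.+1 P)%E.
  apply: lo => //.
  - by rewrite divr_ge0 ?(ltW q0) // mulr_ge0 ?subr_ge0 // exprn_ge0 // ltW.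
  - by move=> a h; have /andP[] := offsN a h.
  - by move=> x y z; have /andP[] := AB x y z.
have c0 : (0 <= csum p n.+1 P)%E.
  by apply: esum_ge0 => v _; rewrite lee_fin !mulr_ge0 ?P0.
(* The upper bound is on [(H ^ k) ^ 3] times the sum, a factor at least 1, so the sum itself is
   finite and [fine] loses nothing. *)
have cf : csum p n.+1 P \is a fin_num.
  rewrite ge0_fin_numE //.
  have : (csum p n.+1 P <= ((((H ^ k) ^ 3)%N%:R)%:E * csum p n.+1 P))%E.
    by rewrite -[leLHS]mul1e lee_wpmul2r // lee_fin ler1n !expn_gt0 H0.
  by move=> /le_trans /(_ up) /le_lt_trans; apply; rewrite ltry.
have SE : S = fine (csum p n.+1 P) * q%:R / N ^+ 3 by rewrite /S smooth_countE.
rewrite -(fineK cf) -EFinM lee_fin in up.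
rewrite -(fineK cf) -EFinM lee_fin in lo.
move: up lo; rewrite natrX -/w SE; set c := fine _ => up lo.
have w3 : 0 < w ^+ 3 by rewrite exprn_gt0.
have N3 : 0 < N ^+ 3 by rewrite exprn_gt0.
have {}up : c * q%:R <= (density R p + e) * zp ^+ 3.
  rewrite -(ler_pM2l w3) mulrA -ler_pdivlMr //; apply: le_trans up _.
  by rewrite le_eqVlt; apply/orP; left; apply/eqP; ring.
have {}lo : (density R p - e) * zm ^+ 3 <= c * q%:R.
  rewrite -(ler_pM2l w3) [leRHS]mulrA -ler_pdivrMr //; apply: le_trans lo.
  by rewrite le_eqVlt; apply/orP; left; apply/eqP; ring.
have Kn : 0 <= J - K * eta by rewrite subr_ge0.
have Ke0 : 0 <= K * eta by exact: mulr_ge0 (ltW K0) (ltW eta0).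
have Jp : 0 <= J + K * eta by lra.
have zp0 : 0 <= zp by rewrite (le_trans _ sGp) // mulr_ge0 ?(ltW N0) //;
  apply: le_trans etaJ; rewrite mulr_ge0 // ltW.
apply/andP; split.
  rewrite ler_pdivlMr //; apply: le_trans lo; rewrite -mulrA -exprMn mulrC.
  rewrite [leRHS]mulrC ler_wpM2r ?subr_ge0 // lerXn2r ?nnegrE //.
    by rewrite mulr_ge0 // ltW.
  by rewrite mulrC.
rewrite ler_pdivrMr //; apply: le_trans up _; rewrite -mulrA -exprMn.
rewrite ler_wpM2l ?addr_ge0 // lerXn2r ?nnegrE //; last by rewrite mulrC.
by rewrite mulr_ge0 ?(ltW N0).
Qed.

(** Since [H] is about [p ^ (n / 2 + 2 * d)], the excess [3 / D] of [nu] over 1/2 covers [2 * d]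
    from [H] and leaves a spare [p ^ d], which dominates [(7 / 4) ^ d]. *)
Lemma box_ratio_le (R : realType) (p D n d H : nat) (nu N : R) : prime p ->
  (5 < p)%N -> (2 < D)%N -> 1 / 2 + 3 / D%:R <= nu -> (D <= n)%N ->
  d = (n %/ D)%N -> H = (p ^ (n.+1 - (n./2 - d) + d))%N ->
  p%:R `^ (n.+1%:R * nu) <= N ->
  (5 * D * H)%N%:R / N <= (5 * D * p)%N%:R * (4 / 7) ^+ d.
Proof.
move=> pp p5 D2 hnu Dn dE HE hN.
have p0 := prime_gt0 pp; have p0' : 0 < p%:R :> R by rewrite ltr0n.
have p7 : (7 <= p)%N.
  by rewrite ltn_neqAle p5 andbT; apply: contraTneq pp => <-.
have D0 : 0 < D%:R :> R by rewrite ltr0n; lia.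
have dD : (d * D <= n)%N by rewrite dE; exact: leq_trunc_div.
have dn2 : (d <= n./2)%N.
  have : (d * 3 <= d * D)%N by rewrite leq_mul2l D2 orbT.
  lia.
have N0 : 0 < N by apply: lt_le_trans hN; rewrite powR_gt0.
rewrite ler_pdivrMr // -(ler_pM2r (x := p%:R ^+ d)); last by rewrite exprn_gt0.
have key : H%:R * p%:R ^+ d <= p%:R * N.
  have -> : H%:R * p%:R ^+ d = p%:R `^ (n.+1 - (n./2 - d) + d + d)%N%:R :> R.
    by rewrite powR_mulrn ?ler0n // HE natrX -exprD.
  apply: (@le_trans _ _ (p%:R * p%:R `^ (n.+1%:R * nu))); last first.
    by rewrite ler_wpM2l // ltW.
  rewrite -[X in _ <= X * _]powRr1 ?ler0n // -powRD; last first.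
    by rewrite lt0r_neq0 // implybT.
  apply: ler_powR; first by rewrite ler1n.
  have h1 : n.+1%:R * (1 / 2 + 3 / D%:R) <= n.+1%:R * nu.
    by rewrite ler_wpM2l ?ler0n.
  apply: le_trans (lerD (lexx 1) h1).
  have h2 : 3 * d%:R <= n.+1%:R * (3 / D%:R) :> R.
    rewrite mulrCA mulrA ler_pdivlMr // -mulrA ler_wpM2l //.
    by rewrite -natrM ler_nat; lia.
  (* Doubled to avoid halves; the rounding of [n / 2] costs at most one unit in the exponent, whence
     the extra factor [p] in [key]. *)
  have h3 : 2 * (n.+1 - (n./2 - d) + d + d)%N%:R <= n%:R + 3 + 6 * d%:R :> R.
    by rewrite -!natrM -!natrD ler_nat; move: dn2; clear; lia.
  move: h2 h3; rewrite mulrDr -natr1; lra.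
have f47 : 1 <= (4 / 7) ^+ d * p%:R ^+ d :> R.
  rewrite -exprMn exprn_ege1 //.
  have : (7%:R : R) <= p%:R by rewrite ler_nat.
  by lra.
rewrite natrM -mulrA.
apply: (@le_trans _ _ ((5 * D)%N%:R * (p%:R * N))).
  by rewrite ler_wpM2l // ler0n.
have -> : (5 * D * p)%N%:R * (4 / 7) ^+ d * N * p%:R ^+ d =
  (5 * D)%N%:R * (p%:R * N) * ((4 / 7) ^+ d * p%:R ^+ d) :> R.
  by rewrite natrM; ring.
by rewrite ler_peMr // mulr_ge0 ?ler0n // mulr_ge0 // ltW.
Qed.

(** * Passage to the limit *)

Lemma geometric_div_cvg (R : realType) (D : nat) : (0 < D)%N ->
  ((4 / 7 : R) ^+ (n %/ D)%N) @[n --> \oo] --> (0 : R).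
Proof.
move=> D0.
have c : (fun n : nat => (n %/ D)%N) @ \oo --> \oo.
  apply/cvgnyPge => A; near=> n; rewrite leq_divRL //.
  by near: n; exact: nbhs_infty_ge.
apply: (@cvg_comp _ _ _ (fun n => (n %/ D)%N)
  (fun d : nat => (4 / 7 : R) ^+ d) _ _ _ c).
by apply: cvg_expr; rewrite ger0_norm ?divr_ge0 // ltr_pdivrMr //; lra.
Unshelve. all: by end_near.
Qed.

Lemma density_gt0 (R : realType) (p : nat) : (5 < p)%N -> 0 < density R p.
Proof.
move=> p5; have h1 : 0 < p%:R - 1 :> R by rewrite subr_gt0 ltr1n; lia.
have h2 : 0 < p%:R - (s p)%:R :> R.
  by rewrite subr_gt0 ltr_nat /s; case: ifP => _; lia.
have h3 : 0 < p%:R ^+ 2 :> R by rewrite exprn_gt0 // ltr0n; lia.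
by rewrite /density divr_gt0 // mulr_gt0.
Qed.

Lemma cubic_cvg (R : realType) (a b c d : R) (t : nat -> R) :
  t n @[n --> \oo] --> (0 : R) ->
  (a + b * t n) * (c + d * t n) ^+ 3 @[n --> \oo] --> a * c ^+ 3.
Proof.
move=> t0.
have lin (x y : R) : x + y * t n @[n --> \oo] --> x.
  have h := cvgD (cvg_cst x) (cvgM (cvg_cst y) t0).
  by rewrite mulr0 addr0 in h; exact: h.
exact: cvgM (lin a b) (cvgM (lin c d) (cvgM (lin c d) (lin c d))).
Qed.

Lemma smooth_count_cvg (R : realType) (nu : R) (Phi : R -> R) (p : nat)
    (N : nat -> R) (J : R) :
  1 / 2 < nu -> (forall x, 0 <= Phi x) -> schwartz Phi ->
  prime p -> (5 < p)%N -> (forall n, 0 < N n) ->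
  (forall n : nat, p%:R `^ (n%:R * nu) <= N n) ->
  (\int[lebesgue_measure]_x (Phi x)%:E = J%:E)%E -> 0 < J ->
  (smooth_count Phi p n (N n) * (p ^ n)%N%:R / N n ^+ 3) @[n --> \oo]
    --> density R p * J ^+ 3.
Proof.
move=> hnu P0 hs pp p5 N0 hN hJ J0.
have d0 := density_gt0 R p5.
have nu0 : 0 < nu - 1 / 2 by rewrite subr_gt0.
(* One successor would already give [3 / D < nu - 1 / 2]; the other two ensure [2 < D]. *)
pose D := (Num.truncn (3 / (nu - 1 / 2))).+3.
have hD : 1 / 2 + 3 / D%:R <= nu.
  rewrite -lerBrDl ler_pdivrMr ?ltr0n // mulrC -ler_pdivrMr //.
  apply: ltW; apply: lt_le_trans (truncnS_gt _) _.
  by rewrite ler_nat; exact: leq_trans (leqnSn _) (leqnSn _).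
have [K K0 hK] := count_estimate pp p5 (isT : (2 < D)%N) P0 hs hJ.
pose t (n : nat) : R := (4 / 7) ^+ (n %/ D)%N.
have t0 : t n @[n --> \oo] --> (0 : R) by exact: geometric_div_cvg.
have tge n : 0 <= t n by rewrite exprn_ge0 // divr_ge0.
pose B : R := (5 * D * p)%N%:R.
have B0 : 0 < B by rewrite ltr0n !muln_gt0 (prime_gt0 pp).
have small c : 0 < c -> \forall m \near \oo, t m <= c.
  move=> c0; near=> m; apply: ltW.
  have : `|0 - t m| < c by near: m; move/cvgrPdist_lt : t0; apply.
  by rewrite sub0r normrN ger0_norm.
(* All estimates are stated for the modulus [p ^ n.+1]. *)
rewrite -cvg_shiftS /=.
apply: (@squeeze_cvgr _ _ _ _
  (fun n => (density R p - K * t n) * (J - K * (B * t n)) ^+ 3)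
  (fun n => (density R p + K * t n) * (J + K * (B * t n)) ^+ 3)).
- near=> n.
  have Dn : (D <= n)%N by near: n; exact: nbhs_infty_ge.
  pose d := (n %/ D)%N; pose H := (p ^ (n.+1 - (n./2 - d) + d))%N.
  have eB := box_ratio_le pp p5 (isT : (2 < D)%N) hD Dn (erefl d) (erefl H)
    (hN n.+1).
  rewrite -/B -/(t n) in eB; set eta := _ / _ in eB.
  have Bt1 : B * t n <= 1.
    rewrite mulrC -ler_pdivlMr //; near: n; apply: small; exact: divr_gt0.
  have KBt : K * (B * t n) <= J.
    rewrite mulrA mulrC -ler_pdivlMr ?mulr_gt0 //.
    by near: n; apply: small; rewrite divr_gt0 // mulr_gt0.
  have Kt : K * t n <= density R p.
    by rewrite mulrC -ler_pdivlMr //; near: n; apply: small; exact: divr_gt0.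
  have eta0 : 0 <= eta by rewrite divr_ge0 ?ler0n // ltW.
  have Ke : K * eta <= K * (B * t n) by rewrite ler_wpM2l // ltW.
  have /andP[lo up] := hK n d H (N n.+1) Dn (erefl d) (erefl H) (N0 n.+1)
    (le_trans eB Bt1) Kt (le_trans Ke KBt).
  apply/andP; split.
    apply: le_trans lo; rewrite ler_wpM2l ?subr_ge0 // lerXn2r ?nnegrE //.
    - by rewrite subr_ge0.
    - by rewrite subr_ge0 (le_trans Ke).
    - by rewrite lerD2l lerN2.
  apply: le_trans up _; rewrite ler_wpM2l //.
    by rewrite addr_ge0 ?(ltW d0) // mulr_ge0 // ltW.
  rewrite lerXn2r ?nnegrE ?lerD2l // addr_ge0 ?(ltW J0) // mulr_ge0 ?(ltW K0) //.
  by rewrite mulr_ge0 // ltW.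
- have h := @cubic_cvg R (density R p) (- K) J (- (K * B)) t t0.
  under eq_fun do rewrite [K * (B * _)]mulrA -mulNr -[- (K * B * _)]mulNr.
  exact: h.
- have h := @cubic_cvg R (density R p) K J (K * B) t t0.
  under eq_fun do rewrite [K * (B * _)]mulrA.
  exact: h.
Unshelve. all: by end_near.
Qed.

Lemma asymptotic_real (R : realType) (A B : nat -> R[i]) (u : nat -> R) :
  (forall n, A n / B n = (u n)%:C) -> u n @[n --> \oo] --> (1 : R) ->
  asymptotic A B.
Proof.
move=> AB /cvgrPdist_lt u1; apply/cvgrPdist_lt => e e0.
(* In the order of [R[i]], a positive element is real, so the complex tolerance reduces to a real
   one. *)
have eR : e = (complex.Re e)%:C by rewrite RRe_real // realE ltW.
have e0' : 0 < complex.Re e by rewrite -ltcR -eR.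
near=> n; rewrite AB -(rmorph1 (real_complex R)) -rmorphB norm_complex_real eR ltcR.
by near: n; exact: u1.
Unshelve. all: by end_near.
Qed.

Unset Implicit Arguments.
Set Strict Implicit.

Theorem theorem1 (R : realType) (eps nu : R) (heps : 0 < eps)
  (hnu : 1 / 2 < nu)
  (Phi : R -> R) (hPhi_ge0 : forall x : R, 0 <= Phi x)
  (hPhi : schwartz Phi) (hPhi_neq0 : exists x : R, Phi x != 0)
  (p : nat) (hp : prime p) (hp5 : (5 < p)%N)
  (N : nat -> R) (hN_gt0 : forall n : nat, 0 < N n)
  (hN : forall n : nat, p%:R `^ (n%:R * nu) <= N n) :
  asymptotic
    (fun n : nat => (smooth_count Phi p n (N n))%:C)
    (fun n : nat => fourier Phi 0 ^+ 3
       * ((p%:R - (s p)%:R) * (p%:R - 1) / p%:R ^+ 2)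
       * ((N n)%:C ^+ 3 / p%:R ^+ n)).
Proof.
have [J J0 hJ] := schwartz_integral hPhi_ge0 hPhi hPhi_neq0.
have d0 := density_gt0 R hp5.
(* A nonzero limit turns convergence of the normalised count into a quotient tending to 1. Here [J]
   is positive because [Phi] is nonnegative and not identically zero. *)
have L0 : density R p * J ^+ 3 != 0.
  by rewrite lt0r_neq0 // mulr_gt0 // exprn_gt0.
have lim := smooth_count_cvg hnu hPhi_ge0 hPhi hp hp5 hN_gt0 hN hJ J0.
have p0 : p%:R != 0 :> R by rewrite pnatr_eq0 -lt0n prime_gt0.
rewrite (fourier0 hJ).
apply: (@asymptotic_real _ _ _ (fun n => smooth_count Phi p n (N n) *
  (p ^ n)%N%:R / N n ^+ 3 * (density R p * J ^+ 3)^-1)) => [n|].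
  have -> : (smooth_count Phi p n (N n) * (p ^ n)%N%:R / N n ^+ 3 *
    (density R p * J ^+ 3)^-1) = smooth_count Phi p n (N n) /
    (J ^+ 3 * density R p * (N n ^+ 3 / p%:R ^+ n)).
    by rewrite natrX; field; rewrite expf_neq0 // !lt0r_neq0.
  rewrite /density fmorph_div /= !rmorphM /= !fmorphV /= !rmorphM /= !rmorphXn /=.
  by rewrite !rmorphB /= !rmorph_nat rmorph1.
have h := cvgM lim (cvg_cst (density R p * J ^+ 3)^-1).
by rewrite (divff L0) in h; exact: h.
Qed.
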